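(* Let $G$ be a simply connected simple complex Lie group of classical type with Lie algebra $\mathfrak{g}$ and Cartan subalgebra $\mathfrak h$, and let $\mu\in P^\vee$. Let $\varphi_\mu$ be the automorphism $x\mapsto\tau_\mu x\tau_\mu^{-1}$, $\tau_\mu=\exp(\ln(\xi)\,\mu)$, of the loop algebra $\mathfrak g\otimes\mathbb C((\xi))$. Then the single-shift automorphism $\sigma_\mu$ is the unique extension of $\varphi_\mu$ to $\widehat{\mathfrak g}$; that is, $\sigma_\mu$ is the unique Lie algebra automorphism of $\widehat{\mathfrak g}$ which induces $\varphi_\mu$ on $\widehat{\mathfrak g}/\mathbb Cc=\mathfrak g\otimes\mathbb C((\xi))$.
   Context: $\Delta$ is the set of roots of $(\mathfrak g,\mathfrak h)$. The coweight lattice is $P^\vee=\{x\in\mathfrak h:\alpha(x)\in\mathbb Z\text{ for all }\alpha\in\Delta\}$. Let $\langle\,,\,\rangle$ be the Cartan–Killing form on $\mathfrak g$ normalized so that $\langle\theta,\theta\rangle=2$ for the longest root $\theta$. The affine Lie algebra is $\widehat{\mathfrak g}=\mathfrak g\otimes\mathbb C((\xi))\oplus\mathbb Cc$, with $c$ central and $[X\otimes f,Y\otimes g]=[X,Y]\otimes fg+\langle X,Y\rangle\operatorname{Res}_{\xi=0}(g\,df)\,c$. Write $X(n)=X\otimes\xi^n$, and for each $\alpha\in\Delta$ let $X_\alpha$ be a nonzero element of the root space $\mathfrak g_\alpha$, chosen as part of a Chevalley basis. For $\mu\in P^\vee$ the single-shift automorphism $\sigma_\mu$ of $\widehat{\mathfrak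 g}$ is given by $\sigma_\mu(c)=c$, $\sigma_\mu(h(n))=h(n)+\delta_{n,0}\langle\mu,h\rangle c$ for $h\in\mathfrak h$, $n\in\mathbb Z$, and $\sigma_\mu(X_\alpha(n))=X_\alpha(n+\alpha(\mu))$, extended to Laurent series in the evident way: $h\otimes f\mapsto h\otimes f+\langle\mu,h\rangle\operatorname{Res}_{\xi=0}(\xi^{-1}f\,d\xi)\,c$ and $X_\alpha\otimes f\mapsto X_\alpha\otimes\xi^{\alpha(\mu)}f$. The expression $\tau_\mu x\tau_\mu^{-1}$ is computed with $\mathfrak g$ realized as a classical matrix Lie algebra with $\mathfrak h$ diagonal; $\tau_\mu$ is a diagonal matrix whose entries are (possibly fractional) powers of $\xi$, depending on a branch of the logarithm, but conjugation by $\tau_\mu$ does not depend on the branch. *)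

(* Defs.v *)
From HB Require Import structures.
From mathcomp Require Import all_boot all_order all_algebra.
From mathcomp Require Import complex ring.
From mathcomp Require Import boolp classical_sets cardinality fsbigop.
From mathcomp Require Import reals sequences exp trigo.

Set Implicit Arguments.
Unset Strict Implicit.
Unset Printing Implicit Defensive.

Import Order.TTheory GRing.Theory Num.Theory.

Local Open Scope classical_set_scope.
Local Open Scope ring_scope.

(* Formal series [sum_k v_k xi^k] with exponents in K and coefficients in V,
   whose support lies in finitely many half-lines a, a + 1, a + 2, ...
   - For K = int this says exactly that the support is bounded below, so
     [series int C] is the field C((xi)) of formal Laurent series.
   - For K = C it is the extension of C((xi)) by the powers xi^a, a in C;
     it contains the (fractional) powers of xi that occur in tau_mu. *)
Definition well_supported (K : numDomainType) (V : zmodType) (f : K -> V) :=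
  exists s : seq K, forall k, f k != 0 ->
    exists2 a, a \in s & exists n : nat, k = a + n%:R.

Record series (K : numDomainType) (V : zmodType) := Series {
  coef :> K -> V;
  coefP : well_supported coef }.

Section SeriesBase.
Context (K : numDomainType) (V : zmodType).
Implicit Types x y : series K V.

HB.instance Definition _ := gen_eqMixin (series K V).
HB.instance Definition _ := gen_choiceMixin (series K V).

Lemma series_ext x y : (forall k, x k = y k) -> x = y.
Proof.
case: x y => f fP [g gP] /= /funext fg.
by move: fP gP; rewrite fg => fP gP; rewrite (Prop_irrelevance fP gP).
Qed.

Lemma well_supported0 : well_supported (fun _ : K => 0 : V).
Proof. by exists [::] => k; rewrite eqxx. Qed.

Lemma well_supportedN x : well_supported (fun k => - x k).
Proof.
by case: (coefP x) => s sP; exists s => k; rewrite oppr_eq0; apply: sP.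
Qed.

Lemma well_supportedD x y : well_supported (fun k => x k + y k).
Proof.
case: (coefP x) (coefP y) => s sP [t tP]; exists (s ++ t) => k xyk.
have [x0|/sP[a a_s an]] := eqVneq (x k) 0; last first.
  by exists a => //; rewrite mem_cat a_s.
move: xyk; rewrite x0 add0r => /tP[a a_t an].
by exists a => //; rewrite mem_cat a_t orbT.
Qed.

Definition series0 := Series well_supported0.
Definition seriesN x := Series (well_supportedN x).
Definition seriesD x y := Series (well_supportedD x y).

Lemma seriesDA : associative seriesD.
Proof. by move=> x y z; apply: series_ext => k /=; rewrite addrA. Qed.
Lemma seriesDC : commutative seriesD.
Proof. by move=> x y; apply: series_ext => k /=; rewrite addrC. Qed.
Lemma series0D : left_id series0 seriesD.
Proof. by move=> x; apply: series_ext => k /=; rewrite add0r. Qed.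
Lemma seriesND : left_inverse series0 seriesN seriesD.
Proof. by move=> x; apply: series_ext => k /=; rewrite addNr. Qed.

HB.instance Definition _ :=
  GRing.isZmodule.Build (series K V) seriesDA seriesDC series0D seriesND.

Lemma coef0 k : (0 : series K V) k = 0. Proof. by []. Qed.
Lemma coefN x k : (- x) k = - x k. Proof. by []. Qed.
Lemma coefD x y k : (x + y) k = x k + y k. Proof. by []. Qed.

End SeriesBase.

Section SeriesLmod.
Context (K : numDomainType) (F : pzRingType) (V : lmodType F).
Implicit Types x y : series K V.

Lemma well_supportedZ (c : F) x : well_supported (fun k => c *: x k).
Proof.
case: (coefP x) => s sP; exists s => k ck; apply: sP.
by apply: contra_neq ck => ->; rewrite scaler0.
Qed.

Definition seriesZ c x := Series (well_supportedZ c x).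

Lemma seriesZA a b x : seriesZ a (seriesZ b x) = seriesZ (a * b) x.
Proof. by apply: series_ext => k /=; rewrite scalerA. Qed.
Lemma series1Z : left_id 1 seriesZ.
Proof. by move=> x; apply: series_ext => k /=; rewrite scale1r. Qed.
Lemma seriesZDr : right_distributive seriesZ +%R.
Proof. by move=> a x y; apply: series_ext => k /=; rewrite scalerDr. Qed.
Lemma seriesZDl x : {morph seriesZ^~ x : a b / a + b}.
Proof. by move=> a b; apply: series_ext => k /=; rewrite scalerDl. Qed.

HB.instance Definition _ := GRing.Zmodule_isLmodule.Build F (series K V)
  seriesZA series1Z seriesZDr seriesZDl.

Lemma coefZ c x k : (c *: x) k = c *: x k. Proof. by []. Qed.

End SeriesLmod.

(* Series with prescribed coefficients. The default value 0 is never reached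
   below, see [coef_conv] and [coef_map_expo]. *)
Definition mkseries (K : numDomainType) (V : zmodType) (f : K -> V) :
  series K V := if pselect (well_supported f) is left fP then Series fP else 0.

Lemma coef_mkseries (K : numDomainType) (V : zmodType) (f : K -> V) :
  well_supported f -> mkseries f =1 f.
Proof. by rewrite /mkseries; case: pselect. Qed.

(* The Cauchy product of series, with respect to op : U -> V -> W; the sum is
   the finite-support sum. *)
Definition conv (K : numDomainType) (U V W : zmodType) (op : U -> V -> W)
    (x : series K U) (y : series K V) : series K W :=
  mkseries (fun k => \sum_(i \in [set: K]) op (x i) (y (k - i))).

Section Conv.
Context (K : numDomainType).

Lemma finite_conv_supp (U V : zmodType) (x : series K U) (y : series K V) k :
  finite_set [set i | x i != 0 /\ y (k - i) != 0].
Proof.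
case: (coefP x) (coefP y) => s sP [t tP].
pose S (p : K * K) := [set i : K | exists n m : nat,
  i = p.1 + n%:R /\ k - i = p.2 + m%:R].
apply: (@sub_finite_set _ _ (\bigcup_(p in [set` allpairs pair s t]) S p)).
  move=> i [/sP[a a_s [n ian]] /tP[b b_t [m kbm]]].
  exists (a, b) => /=; first exact: allpairs_f.
  by exists n, m.
apply: bigcup_finite; first exact: finite_seq.
move=> [a b] _; rewrite /S /=.
have [[i0 [n0 [m0 [e1 e2]]]]|none] := pselect (exists i, S (a, b) i).
  apply: (@sub_finite_set _ _ ((fun n : nat => a + n%:R) @` `I_(n0 + m0).+1)).
    move=> i [n [m [e3 e4]]]; exists n => //=.
    have : (n + m)%:R = (n0 + m0)%:R :> K.
      rewrite !natrD; apply: (@addrI _ (a + b)); simpl in *.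
      by rewrite addrACA -e3 -e4 addrACA -e1 -e2 ![_ + (k - _)]addrC !subrK.
    by move/eqP; rewrite eqr_nat => /eqP <-; rewrite ltnS leq_addr.
  exact/finite_image/finite_II.
rewrite (_ : [set _ | _] = set0) //; apply/seteqP; split=> // i Si.
by apply: none; exists i.
Qed.

Lemma well_supported_conv (U V W : zmodType) (op : U -> V -> W)
    (x : series K U) (y : series K V) :
  (forall v, op 0 v = 0) -> (forall u, op u 0 = 0) ->
  well_supported (fun k => \sum_(i \in [set: K]) op (x i) (y (k - i))).
Proof.
move=> op0 op0'; case: (coefP x) (coefP y) => s sP [t tP].
exists (allpairs +%R s t) => k; have := @fsbigN1 _ 0 +%R K K setT
  (fun k i => op (x i) (y (k - i))) k.
move=> /[apply] -[i _ opi].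
have /sP[a a_s [n ian]] : x i != 0 by apply: contra_neq opi => ->.
have /tP[b b_t [m kbm]] : y (k - i) != 0 by apply: contra_neq opi => ->.
exists (a + b); first exact: allpairs_f.
by exists (n + m)%N; rewrite natrD addrACA -ian -kbm addrC subrK.
Qed.

Lemma coef_conv (U V W : zmodType) (op : U -> V -> W)
    (x : series K U) (y : series K V) k :
  (forall v, op 0 v = 0) -> (forall u, op u 0 = 0) ->
  conv op x y k = \sum_(i \in [set: K]) op (x i) (y (k - i)).
Proof. by move=> op0 op0'; rewrite coef_mkseries//; exact: well_supported_conv. Qed.

Lemma finite_conv_supp3 (U V W : zmodType)
    (x : series K U) (y : series K V) (z : series K W) k :
  finite_set [set p : K * K |
    [/\ x p.2 != 0, y (p.1 - p.2) != 0 & z (k - p.1) != 0]].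
Proof.
case: (coefP x) (coefP y) (coefP z) => s sP [t tP] [u uP].
pose S (q : K * K * K) := [set p : K * K | exists n m l : nat,
  [/\ p.2 = q.1.1 + n%:R, p.1 - p.2 = q.1.2 + m%:R & k - p.1 = q.2 + l%:R]].
pose D := allpairs pair (allpairs pair s t) u.
apply: (@sub_finite_set _ _ (\bigcup_(q in [set` D]) S q)).
  move=> [i j] /= [/sP[a a_s [n ?]] /tP[b b_t [m ?]] /uP[c c_u [l ?]]].
  exists (a, b, c) => /=; last by exists n, m, l.
  by apply/allpairs_f => //; apply/allpairs_f.
apply: bigcup_finite; first exact: finite_seq.
move=> [[a b] c] _.
have [[p0 [n0 [m0 [l0 [e1 e2 e3]]]]]|none] := pselect (exists i, S (a, b, c) i).
  pose M := (n0 + m0 + l0).+1.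
  apply: (@sub_finite_set _ _ ((fun q : nat * nat =>
    (a + q.1%:R + (b + q.2%:R), a + q.1%:R)) @` (`I_M `*` `I_M))); last first.
    by apply/finite_image/finite_setX; apply: finite_II.
  move=> p [n [m [l [e4 e5 e6]]]].
  have : (n + m + l)%:R = (n0 + m0 + l0)%:R :> K.
    have sE (q : K * K) n' m' l' : q.2 = a + n'%:R -> q.1 - q.2 = b + m'%:R ->
        k - q.1 = c + l'%:R -> (n' + m' + l')%:R = k - (a + b + c).
      move=> f1 f2 f3; rewrite !natrD.
      rewrite (_ : n'%:R = q.2 - a) ?f1; last by rewrite addrAC subrr add0r.
      rewrite (_ : m'%:R = q.1 - q.2 - b) ?f2; last by rewrite addrAC subrr add0r.
      rewrite (_ : l'%:R = k - q.1 - c) ?f3; last by rewrite addrAC subrr add0r.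
      by rewrite -f1 -f2 -f3; ring.
    by rewrite (sE _ _ _ _ e1 e2 e3) (sE _ _ _ _ e4 e5 e6).
  move/eqP; rewrite eqr_nat => /eqP sumE.
  exists (n, m) => /=; last first.
    by case: p e4 e5 {e6} => i j /= e4 e5; rewrite -e5 -e4 addrC subrK.
  by split; rewrite /M -sumE ltnS -addnA ?leq_addr// addnCA leq_addr.
rewrite (_ : S _ = set0) //; apply/seteqP; split=> // i Si.
by apply: none; exists i.
Qed.

Lemma fsbig_exchange (I J : choiceType) (V : zmodType) (F : I -> J -> V)
    (D : set (I * J)) : finite_set D ->
  (forall i j, F i j != 0 -> D (i, j)) ->
  \sum_(i \in [set: I]) \sum_(j \in [set: J]) F i j =
  \sum_(j \in [set: J]) \sum_(i \in [set: I]) F i j.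
Proof.
move=> Dfin FD; pose D1 := fst @` D; pose D2 := snd @` D.
have D1fin : finite_set D1 by exact: finite_image.
have D2fin : finite_set D2 by exact: finite_image.
have F1 i j : ~ D1 i -> F i j = 0.
  move=> D1i; apply/eqP; apply: contra_notT D1i => /FD Dij.
  by exists (i, j).
have F2 i j : ~ D2 j -> F i j = 0.
  move=> D2j; apply/eqP; apply: contra_notT D2j => /FD Dij.
  by exists (i, j).
transitivity (\sum_(i \in D1) \sum_(j \in D2) F i j).
  rewrite -(fsbig_widen D1 setT)//=; last first.
    by move=> i [_ D1i]; apply: fsbig1 => j _; apply: F1.
  apply: eq_fsbigr => i _; rewrite -(fsbig_widen D2 setT)//= => j [_ D2j].
  exact: F2.
rewrite exchange_fsbig//.
rewrite -(fsbig_widen D2 setT)//=; last first.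
  by move=> i [_ D2i]; apply: fsbig1 => j _; apply: F2.
apply: eq_fsbigr => i _; rewrite -(fsbig_widen D1 setT)//= => j [_ D1j].
exact: F1.
Qed.

End Conv.

Section SeriesRing.
Context (K : numDomainType) (F : idomainType).
Implicit Types x y z : series K F.

Definition seriesM x y : series K F := conv *%R x y.

Lemma coefM x y k :
  seriesM x y k = \sum_(i \in [set: K]) x i * y (k - i).
Proof. by apply: coef_conv => u; rewrite ?mul0r ?mulr0. Qed.

Lemma sub_bij (k : K) : bijective (fun i => k - i).
Proof. by exists (fun i => k - i) => i; rewrite opprB addrCA subrr addr0. Qed.

Lemma add_bij (k : K) : bijective (fun i => i + k).
Proof. by exists (fun i => i - k) => i; rewrite ?addrK ?subrK. Qed.

Lemma seriesMC : commutative seriesM.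
Proof.
move=> x y; apply: series_ext => k; rewrite !coefM.
rewrite (reindex_fsbigT (fun i => k - i)) //; last exact: sub_bij.
apply: eq_fsbigr => i _; rewrite mulrC; congr (_ * _).
by rewrite opprB addrCA subrr addr0.
Qed.

Lemma seriesMA : associative seriesM.
Proof.
move=> x y z; apply: series_ext => k; rewrite !coefM.
under [RHS]eq_fsbigr do rewrite coefM mulr_fsuml.
rewrite (fsbig_exchange (finite_conv_supp3 x y z k)); last first.
  move=> i j /=; rewrite !mulf_eq0 !negb_or => /andP[/andP[-> ->] ->].
  by [].
apply: eq_fsbigr => j _; rewrite coefM mulr_fsumr.
rewrite [RHS](reindex_fsbigT (fun i => i + j)); last exact: add_bij.
apply: eq_fsbigr => i _; rewrite mulrA addrK; congr (_ * _ * z _).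
by rewrite opprD addrA addrAC.
Qed.

Lemma seriesMDl : left_distributive seriesM +%R.
Proof.
move=> x y z; apply: series_ext => k; rewrite coefD !coefM.
pose D := [set i | x i != 0 /\ z (k - i) != 0] `|`
          [set i | y i != 0 /\ z (k - i) != 0].
have Dfin : finite_set D by rewrite finite_setU; split; apply: finite_conv_supp.
have out i : ~ D i -> x i * z (k - i) = 0 /\ y i * z (k - i) = 0.
  move=> /not_orP[/= xz yz]; split; apply/eqP.
    by apply: contra_notT xz; rewrite mulf_eq0 negb_or => /andP.
  by apply: contra_notT yz; rewrite mulf_eq0 negb_or => /andP.
rewrite -3?(fsbig_widen D setT)//=; first last.
- by move=> i [_ /out[? ?]] /=; rewrite mulrDl; apply/eqP; rewrite addr_eq0;
    apply/eqP; transitivity (0 : F) => //; rewrite -[LHS]oppr0; congr (- _).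
- by move=> i [_ /out[]].
- by move=> i [_ /out[]].
by rewrite -fsbig_split//; apply: eq_fsbigr => i _; rewrite mulrDl.
Qed.

End SeriesRing.

Lemma well_supported_mono (K : numDomainType) (V : zmodType) (a : K) (v : V) :
  well_supported (fun k => if k == a then v else 0).
Proof.
exists [:: a] => k; case: (eqVneq k a) => [-> _|_]; last by rewrite eqxx.
by exists a; [rewrite inE | exists 0%N; rewrite addr0].
Qed.

(* The monomial v xi^a. *)
Definition mono (K : numDomainType) (V : zmodType) (a : K) (v : V) :
  series K V := Series (well_supported_mono a v).

Section SeriesComRing.
Context (K : numDomainType) (F : idomainType).
Implicit Types x y : series K F.

Lemma coef_monoM a c x k : seriesM (mono a c) x k = c * x (k - a).
Proof.
rewrite coefM -(fsbig_widen [set a] setT)//=.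
  by rewrite fsbig_set1 eqxx.
by move=> i [_ /= /eqP/negPf ia]; rewrite ia mul0r.
Qed.

Lemma series1M : left_id (mono 0 1) (@seriesM K F).
Proof. by move=> x; apply: series_ext => k; rewrite coef_monoM mul1r subr0. Qed.

Lemma series1_neq0 : mono 0 1 != 0 :> series K F.
Proof.
by apply/eqP => /(congr1 (fun x : series K F => x 0))/eqP; rewrite /= eqxx oner_eq0.
Qed.

HB.instance Definition _ := GRing.Zmodule_isComNzRing.Build (series K F)
  (@seriesMA K F) (@seriesMC K F) series1M (@seriesMDl K F) series1_neq0.

Definition series_unit : pred (series K F) := fun x => `[< exists y, y * x = 1 >].
Definition series_inv x : series K F :=
  if pselect (exists y, y * x = 1) is left xU then sval (cid xU) else x.

Lemma seriesVM : {in series_unit, left_inverse 1 series_inv *%R}.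
Proof.
move=> x /asboolP xU; rewrite /series_inv.
by case: pselect => // xU'; case: cid.
Qed.
Lemma series_unitPl x y : y * x = 1 -> series_unit x.
Proof. by move=> yx; apply/asboolP; exists y. Qed.
Lemma series_inv_out : {in [predC series_unit], series_inv =1 id}.
Proof. by move=> x /asboolPn xU; rewrite /series_inv; case: pselect. Qed.

HB.instance Definition _ := GRing.ComNzRing_hasMulInverse.Build (series K F)
  seriesVM series_unitPl series_inv_out.

End SeriesComRing.

Lemma monoM (K : numDomainType) (F : idomainType) (a b : K) (c d : F) :
  mono a c * mono b d = mono (a + b) (c * d).
Proof.
apply: series_ext => k; rewrite coef_monoM /= subr_eq [b + a]addrC.
by case: ifP; rewrite ?mulr0.
Qed.

(* X (x) f, where X is in V and f is a scalar series. *)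
Section Tensor.
Context (K : numDomainType) (F : idomainType) (V : lmodType F).

Lemma well_supported_tens (X : V) (f : series K F) :
  well_supported (fun k => f k *: X).
Proof.
case: (coefP f) => s sP; exists s => k fX; apply: sP.
by apply: contra_neq fX => ->; rewrite scale0r.
Qed.

Definition tens (X : V) (f : series K F) : series K V :=
  Series (well_supported_tens X f).

End Tensor.

(* The derivative d/dxi and the residue at xi = 0, for Laurent series. *)
Lemma well_supported_deriv (V : zmodType) (x : series int V) :
  well_supported (fun n : int => x (n + 1) *~ (n + 1)).
Proof.
case: (coefP x) => s sP; exists [seq a - 1 | a <- s] => n nx.
have /sP[a a_s [m nam]] : x (n + 1) != 0.
  by apply: contra_neq nx => ->; rewrite mul0rz.
by exists (a - 1); [exact: map_f | exists m; rewrite addrAC -nam addrK].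
Qed.

Definition dser (V : zmodType) (x : series int V) : series int V :=
  Series (well_supported_deriv x).

Definition res (V : zmodType) (x : series int V) : V := x (-1).

(* Applies phi to the coefficients of a Laurent series and views the result as
   a series with exponents in K: the sum has at most one term, as n |-> n%:~R is
   injective. *)
Definition map_expo (K : numDomainType) (V W : zmodType) (phi : V -> W)
    (x : series int V) : series K W :=
  mkseries (fun k => \sum_(n \in [set n : int | n%:~R = k]) phi (x n)).

Section MapExpo.
Context (K : numDomainType) (V W : zmodType) (phi : V -> W).
Hypothesis phi0 : phi 0 = 0.

Lemma well_supported_map_expo (x : series int V) :
  well_supported (fun k : K => \sum_(n \in [set n : int | n%:~R = k]) phi (x n)).
Proof.
case: (coefP x) => s sP; exists [seq a%:~R | a <- s] => k.
have := @fsbigN1 _ 0 +%R K int [set n : int | n%:~R = k] (fun _ n => phi (x n)) k.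
move=> /[apply] -[n /= <- phixn].
have /sP[a a_s [m ->]] : x n != 0 by apply: contra_neq phixn => ->.
exists a%:~R; first exact: map_f.
by exists m; rewrite rmorphD /= rmorph_nat.
Qed.

Lemma coef_map_expo (x : series int V) (n : int) :
  map_expo K phi x n%:~R = phi (x n).
Proof.
rewrite coef_mkseries; last exact: well_supported_map_expo.
rewrite (_ : [set _ | _] = [set n]) ?fsbig_set1//.
by apply/seteqP; split=> m /= => [/intr_inj|->].
Qed.

Lemma coef_map_expo_out (x : series int V) (k : K) :
  (forall n : int, n%:~R != k) -> map_expo K phi x k = 0.
Proof.
move=> nk; rewrite coef_mkseries; last exact: well_supported_map_expo.
by apply: fsbig1 => n /= /eqP; rewrite (negPf (nk n)).
Qed.

End MapExpo.

(* The simply connected simple groups of classical type: SL n is SL_n(C),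
   Spin n is the universal cover of SO_n(C), and Sp n is Sp_2n(C). Only their
   Lie algebras matter below. *)
Inductive classical_group := SL of nat | Spin of nat | Sp of nat.

Definition simple_group G := match G with
  | SL n => 2 <= n
  | Spin n => (n == 3) || (5 <= n)
  | Sp n => 1 <= n
  end%N.

Definition mxdim G := match G with
  | SL n => n
  | Spin n => n
  | Sp n => n + n
  end%N.

Section LieAlgebra.
Context (R : realType).
Local Notation C := R[i].

(* The bilinear forms defining so_n and sp_2n are antidiagonal, so that the
   diagonal matrices form a Cartan subalgebra. *)
Definition so_form n : 'M[C]_n := \matrix_(i, j) (j == rev_ord i)%:R.
Definition sp_form n : 'M[C]_(n + n) :=
  \matrix_(i, j) ((-1) ^+ (n <= i)%N * (j == rev_ord i)%:R).

Definition skew_defect n (J X : 'M[C]_n) : 'M[C]_n := X^T *m J + J *m X.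

Lemma skew_defect_linear n (J : 'M[C]_n) : linear (skew_defect J).
Proof.
move=> a X Y; rewrite /skew_defect linearP /= mulmxDl mulmxDr -scalemxAl.
by rewrite -scalemxAr scalerDr addrACA.
Qed.
HB.instance Definition _ n (J : 'M[C]_n) :=
  GRing.isLinear.Build C _ _ _ (skew_defect J) (skew_defect_linear J).

Definition lie_sub G : {vspace 'M[C]_(mxdim G)} :=
  match G return {vspace 'M[C]_(mxdim G)} with
  | SL n => lker (linfun (mxtrace : 'M[C]_n -> C^o))
  | Spin n => lker (linfun (skew_defect (so_form n)))
  | Sp n => lker (linfun (skew_defect (sp_form n)))
  end.

Lemma mem_lie_sub G (X : 'M[C]_(mxdim G)) : (X \in lie_sub G) =
  match G return 'M[C]_(mxdim G) -> bool with
  | SL n => fun X => \tr X == 0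
  | Spin n => fun X => X^T *m so_form n + so_form n *m X == 0
  | Sp n => fun X => X^T *m sp_form n + sp_form n *m X == 0
  end X.
Proof. by case: G X => n X; rewrite memv_ker lfunE. Qed.

Lemma lie_sub_bracket G (X Y : 'M[C]_(mxdim G)) :
  X \in lie_sub G -> Y \in lie_sub G -> X *m Y - Y *m X \in lie_sub G.
Proof.
have skew n (J A B : 'M[C]_n) : A^T *m J + J *m A == 0 ->
    B^T *m J + J *m B == 0 -> (A *m B - B *m A)^T *m J + J *m (A *m B - B *m A) == 0.
  rewrite !addr_eq0 => /eqP AJ /eqP BJ.
  rewrite linearB /= !trmx_mul mulmxBl mulmxBr -!mulmxA AJ BJ !mulmxN !mulmxA.
  by rewrite AJ BJ !mulNmx !opprK opprB.
case: G X Y => n X Y; rewrite !mem_lie_sub; [|exact: skew|exact: skew].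
by move=> _ _; rewrite linearB /= mxtrace_mulC subrr.
Qed.

Variable G : classical_group.
Local Notation N := (mxdim G).

Definition glie := subvs_of (lie_sub G).
HB.instance Definition _ := Vector.on glie.

Definition bracket (X Y : glie) : glie :=
  vsproj (lie_sub G) (vsval X *m vsval Y - vsval Y *m vsval X).

Lemma val_bracket X Y : vsval (bracket X Y) = vsval X *m vsval Y - vsval Y *m vsval X.
Proof. by rewrite vsprojK// lie_sub_bracket// subvsP. Qed.

Lemma bracket_linear X : linear (bracket X).
Proof.
move=> a Y Z; apply: val_inj; rewrite [RHS]linearP /=.
rewrite !val_bracket !linearP /= mulmxDl -scalemxAl.
by rewrite scalerBr opprD addrACA.
Qed.
HB.instance Definition _ X :=
  GRing.isLinear.Build C glie glie _ (bracket X) (bracket_linear X).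

Definition ad (X : glie) : 'End(glie) := linfun (bracket X).

Definition lfun_trace (f : 'End(glie)) : C :=
  \tr (passmx.mxof (vbasis {:glie}) (vbasis {:glie}) f).

Definition killing (X Y : glie) : C := lfun_trace (ad X \o ad Y).

(* The Cartan subalgebra h of diagonal matrices of g. *)
Definition offdiag (X : glie) : 'M[C]_N :=
  \matrix_(i, j) (vsval X i j *+ (i != j)).

Lemma offdiag_linear : linear offdiag.
Proof.
move=> a X Y; apply/matrixP => i j; rewrite !mxE /=.
by rewrite mulrnDl mulrnAr.
Qed.
HB.instance Definition _ :=
  GRing.isLinear.Build C glie _ _ offdiag offdiag_linear.

Definition cartan_sub : {vspace glie} := lker (linfun offdiag).

Lemma mem_cartan_sub X : (X \in cartan_sub) = is_diag_mx (vsval X).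
Proof.
rewrite memv_ker lfunE /=; apply/eqP/is_diag_mxP => [X0 i j ij|X0].
  by have /matrixP/(_ i j) := X0; rewrite !mxE ij.
by apply/matrixP => i j; rewrite !mxE; case: eqVneq => //= /X0 ->.
Qed.

Definition cartan := subvs_of cartan_sub.
HB.instance Definition _ := Vector.on cartan.

Definition cartan_dual := 'Hom(cartan, C^o).

Definition in_root_space (alpha : cartan_dual) (X : glie) :=
  forall H : cartan, bracket (vsval H) X = alpha H *: X.

(* Delta. *)
Definition is_root (alpha : cartan_dual) :=
  alpha != 0 /\ exists2 X, X != 0 & in_root_space alpha X.

(* P^v. *)
Definition in_coweight_lattice (mu : cartan) :=
  forall alpha, is_root alpha -> exists n : int, alpha mu = n%:~R.

(* t represents alpha with respect to the form; then form t t is the square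
   length <alpha, alpha>. *)
Definition represents (form : glie -> glie -> C) (alpha : cartan_dual)
    (t : cartan) := forall H : cartan, form (vsval t) (vsval H) = alpha H.

(* The multiple of the Killing form with <theta, theta> = 2 for the longest
   roots theta. *)
Definition normalized_form (form : glie -> glie -> C) :=
  (exists c : C, forall X Y, form X Y = c * killing X Y) /\
  (exists (theta : cartan_dual) (t : cartan),
    [/\ is_root theta, represents form theta t, form (vsval t) (vsval t) = 2 &
        forall alpha s, is_root alpha -> represents form alpha s ->
          form (vsval s) (vsval s) <= form (vsval t) (vsval t)]).

(* C((xi)), and g (x) C((xi)) as Laurent series with coefficients in g. *)
Definition laurent := series int C.
Definition loop := series int glie.
HB.instance Definition _ := GRing.ComUnitRing.on laurent.
HB.instance Definition _ := GRing.Lmodule.on loop.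

Definition loop_bracket : loop -> loop -> loop := conv bracket.

Lemma bracketC X Y : bracket X Y = - bracket Y X.
Proof. by apply: val_inj; rewrite linearN /= !val_bracket opprB. Qed.

Lemma loop_bracket_tens X Y (f g : laurent) :
  loop_bracket (tens X f) (tens Y g) = tens (bracket X Y) (f * g).
Proof.
apply: series_ext => k; rewrite coef_conv; last 2 first.
- by move=> Z; rewrite bracketC linear0 oppr0.
- by move=> Z; rewrite linear0.
rewrite /= [(f * g) k]coefM.
pose D := [set i | f i != 0 /\ g (k - i) != 0].
have Dfin : finite_set D := finite_conv_supp f g k.
have out i : ~ D i -> f i * g (k - i) = 0.
  move=> fg; apply/eqP; apply: contra_notT fg.
  by rewrite mulf_eq0 negb_or => /andP.
have brE i : bracket (f i *: X) (g (k - i) *: Y) =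
    (f i * g (k - i)) *: bracket X Y.
  by rewrite linearZ /= bracketC linearZ /= -scalerN -bracketC scalerA mulrC.
under eq_fsbigr do rewrite brE.
have -> : \sum_(i \in [set: int]) f i * g (k - i) =
    \sum_(i \in D) f i * g (k - i).
  by apply/esym/fsbig_widen => // i [_ /out].
have -> : \sum_(i \in [set: int]) (f i * g (k - i)) *: bracket X Y =
    \sum_(i \in D) (f i * g (k - i)) *: bracket X Y.
  by apply/esym/fsbig_widen => // i [_ /out /= ->]; rewrite /= scale0r.
by rewrite !fsbig_finite// scaler_suml.
Qed.

(* The element (x, a) stands for x + a c; see [affine_bracket_tens]. *)
Definition affine := (loop * C^o)%type.
HB.instance Definition _ := GRing.Lmodule.on affine.

Definition affine_bracket (form : glie -> glie -> C) (x y : affine) : affine :=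
  (loop_bracket x.1 y.1, res (conv form (dser x.1) y.1)).

Lemma affine_bracket_tens (form : glie -> glie -> C) X Y (f g : laurent) a b :
  (forall u v c d, form (c *: u) (d *: v) = c * d * form u v) ->
  affine_bracket form (tens X f, a) (tens Y g, b) =
  (tens (bracket X Y) (f * g), form X Y * res (g * dser f)).
Proof.
move=> formZ; rewrite /affine_bracket loop_bracket_tens; congr (_, _).
have form0l v : form 0 v = 0.
  by have := formZ 0 v 0 1; rewrite scaler0 scale1r !mul0r.
have form0r u : form u 0 = 0.
  by have := formZ u 0 1 0; rewrite scaler0 scale1r mulr0 mul0r.
rewrite /res coef_conv// [g * _]mulrC [(dser f * g) _]coefM mulr_fsumr.
apply: eq_fsbigr => i _ /=.
by rewrite -scaler_int scalerA formZ mulrC mulrzl.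
Qed.

Definition central : affine := (0, 1).

Definition lie_automorphism (L : lmodType C) (br : L -> L -> L) (f : L -> L) :=
  [/\ linear f, bijective f & forall x y, f (br x y) = br (f x) (f y)].

(* psi induces phi on the quotient of [affine] by the center C c. *)
Definition induces (psi : affine -> affine) (phi : loop -> loop) :=
  forall x, (psi x).1 = phi x.1.

Definition xi (n : int) : laurent := mono n 1.

(* sigma is the single shift sigma_mu; Xr alpha is the root vector X_alpha, and
   Res(xi^-1 f dxi) is the residue of xi (-1) * f. *)
Definition single_shift (form : glie -> glie -> C) (Xr : cartan_dual -> glie)
    (mu : cartan) (sigma : affine -> affine) :=
  [/\ linear sigma,
      sigma central = central,
      forall (H : cartan) (f : laurent), sigma (tens (vsval H) f, 0) =
        (tens (vsval H) f, form (vsval mu) (vsval H) * res (xi (-1) * f)) &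
      forall alpha (n : int) (f : laurent), is_root alpha -> alpha mu = n%:~R ->
        sigma (tens (Xr alpha) f, 0) = (tens (Xr alpha) (xi n * f), 0)].

(* The element x of g (x) C((xi)) as a matrix over C((xi)), the latter being
   embedded in the ring of series with complex exponents. *)
Definition loop_mx (x : loop) : 'M[series C C]_N :=
  \matrix_(i, j) map_expo C (fun X : glie => vsval X i j) x.

Definition cexp (z : C) : C :=
  (expR (complex.Re z))%:C%C * (cos (complex.Im z) +i* sin (complex.Im z))%C.

Lemma cexpD z w : cexp (z + w) = cexp z * cexp w.
Proof.
case: z w => [a b] [c d]; rewrite /cexp /= expRD cosD sinD.
by apply/eqP; rewrite eq_complex /=; apply/andP; split; apply/eqP; ring.
Qed.

Lemma cexp0 : cexp 0 = 1.
Proof.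
rewrite /cexp /= expR0 cos0 sin0.
by apply/eqP; rewrite eq_complex /=; apply/andP; split; apply/eqP; ring.
Qed.

(* exp (a ln xi), for the branch ln xi + 2 pi i k of the logarithm. *)
Definition xipow (k : int) (a : C) : series C C :=
  mono a (cexp (a * ((2 * pi) *~ k)*i%C)).

(* tau_mu = exp (ln xi mu). *)
Definition tau (k : int) (mu : cartan) : 'M[series C C]_N :=
  diag_mx (\row_i xipow k (vsval (vsval mu) i i)).

Lemma tau_unitmx k mu : tau k mu \in unitmx.
Proof.
have tauK : tau k mu *m tau k (- mu) = 1%:M.
  rewrite /tau mulmx_diag -[RHS]diag_const_mx; congr diag_mx; apply/rowP => i.
  rewrite [LHS]mxE [RHS]mxE [X in X * _]mxE [X in _ * X]mxE /xipow monoM -cexpD.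
  have -> : vsval (vsval (- mu)) i i = - vsval (vsval mu) i i.
    by rewrite !linearN /= mxE.
  by rewrite mulNr !subrr cexp0.
by have [tauU _] := mulmx1_unit tauK; exact: tauU.
Qed.

End LieAlgebra.

(* Main.v *)
(* The adjoint action of the diagonal matrices splits g into h and
   one-dimensional root spaces: two off-diagonal entries have the same weight
   only if they are mirror images in the antidiagonal, and then the equations
   of so_n and sp_2n relate them. Conjugation by tau_mu multiplies a vector of
   weight alpha by xi^alpha(mu), an integral power, which makes phi_mu an
   automorphism of the loop algebra. As every loop is a finite sum of elements
   X (x) f with X a weight vector, bilinear identities need only be checked on
   such elements; for sigma_mu the identity of cocycles then follows from the
   Leibniz rule and the invariance of the Killing form. Two extensions of phi_mu
   differ by a linear map to the center which vanishes on brackets, hence is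
   zero: g is perfect, so each X (x) f is a sum of brackets [Y (x) 1, Z (x) f],
   and 2c is, up to an element of g (x) C((xi)), the bracket of t (x) xi and
   t (x) xi^-1, where <t, t> = 2. *)
Require Import Defs.
From HB Require Import structures.
From mathcomp Require Import all_boot all_order all_algebra.
From mathcomp Require Import complex ring zify.
From mathcomp Require Import boolp classical_sets cardinality fsbigop.
From mathcomp Require Import reals exp trigo.

Set Implicit Arguments.
Unset Strict Implicit.
Unset Printing Implicit Defensive.

Import Order.TTheory GRing.Theory Num.Theory.

Local Open Scope ring_scope.

(** * The equations of so_n and sp_2n in terms of matrix entries *)

(** The antidiagonal form has one nonzero entry in each row and column, so an entry of [X^T J + J X]
    compares just two entries of [X], mirror images in the antidiagonal. The hypothesis on [e] lets
    their relative sign be written in the unreversed indices. *)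
Lemma skew_defect_eq0 (R : realType) n (e : 'I_n -> bool) (X : 'M[R[i]]_n) :
    (forall i j, e (rev_ord i) (+) e (rev_ord j) = e i (+) e j) ->
  skew_defect (\matrix_(i, j) ((-1) ^+ e i * (j == rev_ord i)%:R)) X = 0 <->
  forall i j, X i j = - (-1) ^+ (e i (+) e j) * X (rev_ord j) (rev_ord i).
Proof.
move=> e_rev; set J := \matrix_(i, j) _.
have defectE a b : skew_defect J X a b =
    (-1) ^+ e (rev_ord b) * X (rev_ord b) a + (-1) ^+ e a * X (rev_ord a) b.
  rewrite !mxE; congr (_ + _).
    rewrite (bigD1 (rev_ord b)) //= big1 ?addr0; last first.
      move=> k nk; rewrite !mxE (_ : b == _ = false) ?mulr0 //.
      by apply: contraNF nk => /eqP ->; rewrite rev_ordK.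
    by rewrite !mxE rev_ordK eqxx mulr1 mulrC.
  rewrite (bigD1 (rev_ord a)) //= big1 ?addr0; last first.
    by move=> k /negPf nk; rewrite mxE nk mulr0 mul0r.
  by rewrite mxE eqxx mulr1.
have signs i j (z : R[i]) : (-1) ^+ e (rev_ord i) * z =
    (-1) ^+ e (rev_ord j) * ((-1) ^+ (e i (+) e j) * z).
  by rewrite mulrA -signr_addb -e_rev addbCA addbb addbF.
split=> [J0 i j|skewX].
  have /eqP := congr1 (fun M : 'M_n => M (rev_ord i) j) J0.
  rewrite /= defectE rev_ordK mxE addrC addr_eq0 => /eqP Xij.
  apply: (can_inj (signrMK (e (rev_ord i)))); rewrite Xij mulNr mulrN.
  congr (- _).
  rewrite (signs i j); congr (_ * _); rewrite mulrA -expr2.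
  by rewrite sqrr_sign mul1r.
apply/matrixP => a b; rewrite defectE mxE (skewX (rev_ord a)) rev_ordK.
rewrite mulNr mulrN; apply/eqP; rewrite subr_eq0; apply/eqP.
have := signs b (rev_ord a) (X (rev_ord b) a); rewrite rev_ordK => ->.
by rewrite addbC.
Qed.

(* The antidiagonal form J defining so_n or sp_2n has entries
   [J i (rev_ord i) = (-1) ^+ form_sign i]. *)
Definition form_sign G : 'I_(mxdim G) -> bool :=
  match G with
  | Sp n => fun i : 'I_(n + n) => (n <= i)%N
  | _ => fun=> false
  end.

Lemma form_sign_rev G (i j : 'I_(mxdim G)) :
  form_sign (rev_ord i) (+) form_sign (rev_ord j) = form_sign i (+) form_sign j.
Proof.
case: G i j => n //= i j.
have E (k : 'I_(n + n)) : (n <= n + n - k.+1)%N = ~~ (n <= k)%N.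
  by have := ltn_ord k; lia.
by rewrite !E; do 2!case: (_ <= _)%N.
Qed.

Definition is_SL G := if G is SL _ then true else false.

Lemma mem_lie_sub_skew (R : realType) G (X : 'M[R[i]]_(mxdim G)) : ~~ is_SL G ->
  X \in lie_sub R G <-> forall i j,
    X i j = - (-1) ^+ (form_sign i (+) form_sign j) * X (rev_ord j) (rev_ord i).
Proof.
move=> nSL; rewrite -(skew_defect_eq0 _ (@form_sign_rev G)).
case: G X nSL => //= n X _; rewrite memv_ker lfunE /=.
  rewrite (_ : \matrix_(_, _) _ = so_form R n).
    by split=> /eqP.
  by apply/matrixP => i j; rewrite !mxE mul1r.
by split=> /eqP.
Qed.

(** * Weights of the diagonal matrices on matrix positions *)

Section Weights.
Context (R : realType) (G : classical_group).
Local Notation C := R[i].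
Local Notation N := (mxdim G).
Local Notation glie := (glie R G).
Local Notation cartan := (cartan R G).
Local Notation cartan_dual := (cartan_dual R G).
Implicit Types (X Y : glie) (H : cartan) (i j : 'I_N).
Implicit Types alpha beta : cartan_dual.

Lemma entryZ (c : C) X i j : vsval (c *: X) i j = c * vsval X i j.
Proof. by rewrite -[vsval (c *: X)]/(c *: vsval X) mxE. Qed.

Lemma cartan_diag H i j : i != j -> vsval (vsval H) i j = 0.
Proof.
by have := subvsP H; rewrite mem_cartan_sub => /is_diag_mxP Hdiag /Hdiag.
Qed.

Lemma bracket_cartan H X i j : vsval (bracket (vsval H) X) i j =
  (vsval (vsval H) i i - vsval (vsval H) j j) * vsval X i j.
Proof.
rewrite val_bracket !mxE (bigD1 i) //= big1 ?addr0; last first.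
  by move=> k ki; rewrite cartan_diag ?mul0r // eq_sym.
rewrite (bigD1 j) //= big1 ?addr0; last first.
  by move=> k kj; rewrite cartan_diag ?mulr0.
by rewrite mulrBl [vsval X i j * _]mulrC.
Qed.

Definition weight_fun i j H : C^o := vsval (vsval H) i i - vsval (vsval H) j j.

Lemma weight_fun_linear i j : linear (weight_fun i j).
Proof.
move=> a H H'; rewrite /weight_fun !linearP /= !mxE.
by rewrite scalerBr addrACA opprD.
Qed.
HB.instance Definition _ i j :=
  GRing.isLinear.Build C cartan C^o _ (weight_fun i j) (weight_fun_linear i j).

(** The weight epsilon_i - epsilon_j by which h acts on the entry at position [(i, j)], see
    [bracket_cartan]. *)
Definition weight i j : cartan_dual := linfun (weight_fun i j).

Lemma weightE i j H : weight i j H = vsval (vsval H) i i - vsval (vsval H) j j.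
Proof. by rewrite lfunE. Qed.

Lemma weightii i : weight i i = 0.
Proof. by apply/lfunP => H; rewrite weightE subrr lfunE. Qed.

Lemma root_space_entry alpha X i j :
  in_root_space alpha X -> vsval X i j != 0 -> weight i j = alpha.
Proof.
move=> Xalpha Xij; apply/lfunP => H; rewrite weightE.
have := congr1 (fun Y => vsval Y i j) (Xalpha H).
by rewrite /= bracket_cartan entryZ => /(mulIf Xij).
Qed.

Lemma skew_entry X i j : ~~ is_SL G -> vsval X i j =
  - (-1) ^+ (form_sign i (+) form_sign j) * vsval X (rev_ord j) (rev_ord i).
Proof. by move=> nSL; apply: (mem_lie_sub_skew _ nSL).1; exact: subvsP. Qed.

Lemma cartan_rev H i : ~~ is_SL G ->
  vsval (vsval H) (rev_ord i) (rev_ord i) = - vsval (vsval H) i i.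
Proof.
by move=> nSL; rewrite [in RHS](skew_entry _ i i nSL) addbb mulN1r opprK.
Qed.

Lemma weight_rev i j : ~~ is_SL G ->
  weight (rev_ord j) (rev_ord i) = weight i j.
Proof.
by move=> nSL; apply/lfunP => H; rewrite !weightE !cartan_rev // opprK addrC.
Qed.

Definition glue_mx (F : cartan_dual -> glie) : 'M[C]_N :=
  \matrix_(i, j) vsval (F (weight i j)) i j.

(** The equations of so_n and sp_2n relate mirror-image positions, which have equal weight. For sl_n
    the trace sees only the diagonal, which has weight 0 and is therefore taken from [F 0]. *)
Lemma glue_mx_sub F : glue_mx F \in lie_sub R G.
Proof.
have [SLG|nSL] := boolP (is_SL G); last first.
  apply/(mem_lie_sub_skew _ nSL) => i j; rewrite !mxE weight_rev //.
  by rewrite -skew_entry.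
have : mxtrace (glue_mx F) = mxtrace (vsval (F 0)).
  by apply: eq_bigr => i _; rewrite mxE weightii.
move: (subvsP (F 0)) SLG; move: (vsval (F 0)) (glue_mx F).
case: (G) => // n A B; rewrite !mem_lie_sub.
by move=> /eqP A0 _ ->; rewrite A0.
Qed.

(* As [lie_sub] is cut out by relations between entries of equal weight, one
   may replace the weight components of an element of g independently. *)
Definition glue (F : cartan_dual -> glie) : glie :=
  vsproj (lie_sub R G) (glue_mx F).

Lemma glueE F i j : vsval (glue F) i j = vsval (F (weight i j)) i j.
Proof. by rewrite vsprojK ?glue_mx_sub // mxE. Qed.

Definition component alpha X := glue (fun beta => X *+ (beta == alpha)).

Lemma componentE alpha X i j :
  vsval (component alpha X) i j = vsval X i j *+ (weight i j == alpha).
Proof. by rewrite glueE; case: eqP; rewrite ?mulr1n // mulr0n linear0 mxE. Qed.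

Lemma component_root_space alpha X : in_root_space alpha (component alpha X).
Proof.
move=> H; apply/val_inj/matrixP => i j /=; rewrite bracket_cartan entryZ.
by rewrite -weightE componentE; case: eqP => [->//|]; rewrite !mulr0.
Qed.

(** Duplicates are removed because several positions share a weight, while [sum_components] must
    count each component once. *)
Definition weights : seq cartan_dual :=
  undup [seq weight p.1 p.2 | p <- enum {: 'I_N * 'I_N}].

Lemma sum_components X : X = \sum_(alpha <- weights) component alpha X.
Proof.
apply/val_inj/matrixP => i j; rewrite linear_sum summxE.
rewrite (bigD1_seq (weight i j)) ?undup_uniq //=; last first.
  by rewrite mem_undup; apply/mapP; exists (i, j); rewrite ?mem_enum.
rewrite componentE eqxx big1 ?addr0 // => alpha nalpha.
by rewrite componentE eq_sym (negPf nalpha).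
Qed.

(** Test elements of h on which every weight takes integral values. They lie in g for all [a], [b]
    in the case of sl_n, and for [b = rev_ord a] in the other cases. *)
Definition diag_delta (a b : 'I_N) : 'M[C]_N := delta_mx a a - delta_mx b b.

Lemma diag_delta_cartan a b : diag_delta a b \in lie_sub R G ->
  exists H, vsval (vsval H) = diag_delta a b.
Proof.
move=> Dg; set X := vsproj (lie_sub R G) (diag_delta a b).
have valX : vsval X = diag_delta a b by rewrite vsprojK.
have Xh : X \in cartan_sub R G.
  rewrite mem_cartan_sub valX; apply/is_diag_mxP => i j ij; rewrite !mxE.
  have /negPf nij : i != j by [].
  have nd (c : 'I_N) : (i == c) && (j == c) = false.
    by apply/negP => /andP[/eqP ic /eqP jc]; rewrite ic jc eqxx in nij.
  by rewrite !nd subr0.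
by exists (vsproj (cartan_sub R G) X); rewrite vsprojK.
Qed.

Lemma diag_delta_sub a b :
  is_SL G || (b == rev_ord a) -> diag_delta a b \in lie_sub R G.
Proof.
have [SLG _|nSL /eqP ->] := boolP (is_SL G).
  rewrite /diag_delta; move: SLG a b; case: (G) => // n _ a b.
  rewrite mem_lie_sub linearB /= -(mul_delta_mx b a a) mxtrace_mulC.
  by rewrite mul_delta_mx subrr.
apply/(mem_lie_sub_skew _ nSL) => i j; rewrite !mxE.
rewrite ![rev_ord _ == _](can2_eq (@rev_ordK _) (@rev_ordK _)) !rev_ordK.
have [->|ij] := eqVneq i j; first by rewrite addbb !andbb mulN1r opprB.
have nd (c : 'I_N) : (i == c) && (j == c) = false.
  by apply/negP => /andP[/eqP ic /eqP jc]; rewrite ic jc eqxx in ij.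
by rewrite !nd ![(j == _) && _]andbC !nd subrr mulr0.
Qed.

Lemma weight_diag_delta a b i j H : vsval (vsval H) = diag_delta a b ->
  weight i j H = ((i == a)%:Z - (i == b)%:Z - ((j == a)%:Z - (j == b)%:Z))%:~R.
Proof. by move=> HE; rewrite weightE HE !mxE !andbb !rmorphB. Qed.

(** Evaluation at [diag_delta a b] turns an equality of weights into one of integers, to which [lia]
    applies. *)
Lemma weight_eq_diag_delta i j k l a b : is_SL G || (b == rev_ord a) ->
  weight i j = weight k l ->
  (i == a)%:Z - (i == b)%:Z - ((j == a)%:Z - (j == b)%:Z) =
  (k == a)%:Z - (k == b)%:Z - ((l == a)%:Z - (l == b)%:Z).
Proof.
move=> /diag_delta_sub/diag_delta_cartan[H HE] /lfunP/(_ H).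
by rewrite !(weight_diag_delta _ _ HE) => /intr_inj.
Qed.

(** The value of epsilon_x at [diag_delta a (rev_ord a)]. *)
Definition antisym_delta (x a : 'I_N) : int :=
  (x == a)%:Z - (x == rev_ord a)%:Z.

Lemma antisym_delta_rev x a : antisym_delta (rev_ord x) a = - antisym_delta x a.
Proof.
rewrite /antisym_delta opprB (inj_eq rev_ord_inj); congr (_ - _).
by rewrite (can2_eq (@rev_ordK _) (@rev_ordK _)).
Qed.

(** If [x] is not fixed by [rev_ord], then [antisym_delta x x = 1] identifies it. Otherwise all
    these numbers are 0, and both indices are the middle one. *)
Lemma antisym_delta_inj x y :
  (forall a, antisym_delta x a = antisym_delta y a) -> x = y.
Proof.
move=> uxy; have := uxy x; have := uxy y; rewrite /antisym_delta !eqxx.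
have [//|xy] := eqVneq x y.
case: (eqVneq x (rev_ord x)) => [xx'|_]; last by case: (eqVneq y (rev_ord x)).
case: (eqVneq y (rev_ord y)) => [yy'|_]; last by case: (eqVneq x (rev_ord y)).
move=> _ _; apply/val_inj; move: (congr1 val xx') (congr1 val yy') => /=.
by have := ltn_ord x; have := ltn_ord y; lia.
Qed.

(** For sl_n the left weight takes the value 2 at [diag_delta i j], which forces [k] and [l]. For
    so_n and sp_2n, evaluation at a suitable index determines [k] or [l], and the other one then
    follows from [antisym_delta_inj]. *)
Lemma weight_inj i j k l : i != j -> weight i j = weight k l ->
  k = i /\ l = j \/ ~~ is_SL G /\ k = rev_ord j /\ l = rev_ord i.
Proof.
have V (x y : 'I_N) : x = y <-> x = y :> nat by split=> [->|/val_inj].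
move=> ij wijkl; have [SLG|nSL] := boolP (is_SL G).
  left; have := weight_eq_diag_delta (a := i) (b := j) _ wijkl.
  rewrite SLG !V => /(_ isT); move: ij; rewrite -!val_eqE /=; clear.
  by move: (val i) (val j) (val k) (val l) => {}i {}j {}k {}l /=; lia.
have uE a : antisym_delta i a - antisym_delta j a =
            antisym_delta k a - antisym_delta l a.
  by apply: weight_eq_diag_delta => //; rewrite eqxx orbT.
have u1 x a : antisym_delta x a = 1 -> x = a.
  by rewrite /antisym_delta; do 2![case: eqP => //].
have uN1 x a : antisym_delta x a = -1 -> x = rev_ord a.
  by rewrite /antisym_delta; do 2![case: eqP => //].
have ule x a : -1 <= antisym_delta x a <= 1.
  by rewrite /antisym_delta; do 2![case: eqP => //].
(* If [i] is the middle index, epsilon_i vanishes on h; then [j] is not the middle index, and the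
   weights are evaluated at [j] instead of [i]. *)
have [ii'|ii'] := eqVneq i (rev_ord i).
  have ui a : antisym_delta i a = 0.
    by have := antisym_delta_rev i a; rewrite -ii'; lia.
  have jj' : j != rev_ord j.
    apply: contra_neq ij; rewrite !V /= in ii' *.
    by have := ltn_ord i; have := ltn_ord j; lia.
  have uj : antisym_delta j j = 1.
    by rewrite /antisym_delta eqxx (negPf jj').
  have : antisym_delta k j = -1 \/ antisym_delta l j = 1.
    by have := uE j; have := ule k j; have := ule l j; rewrite ui uj; lia.
  case=> [/uN1 kE|/u1 lE]; [right|left]; split=> //.
    split=> //; rewrite -ii'; apply: antisym_delta_inj => a.
    by have := uE a; rewrite kE antisym_delta_rev ui; lia.
  by apply: antisym_delta_inj => a; have := uE a; rewrite lE; lia.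
have ui : antisym_delta i i = 1 by rewrite /antisym_delta eqxx (negPf ii').
have : antisym_delta k i = 1 \/ antisym_delta l i = -1.
  have uj : antisym_delta j i <= 0.
    by rewrite /antisym_delta eq_sym (negPf ij); case: eqP.
  by have := uE i; have := ule k i; have := ule l i; rewrite ui; lia.
case=> [/u1 kE|/uN1 lE]; [left|right]; split=> //.
  by apply: antisym_delta_inj => a; have := uE a; rewrite kE; lia.
split=> //; apply: antisym_delta_inj => a.
by have := uE a; rewrite lE !antisym_delta_rev; lia.
Qed.

(** Since [weight i i] is 0, [weight_inj] with [k = l = i] would force [i = j]. *)
Lemma weight_neq0 i j : i != j -> weight i j != 0.
Proof.
move=> ij; apply: contra ij => /eqP wij0; apply/eqP.
have [//|ij] := eqVneq i j; have := @weight_inj i j i i ij.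
rewrite weightii => /(_ wij0).
by case=> [[]//|[_ [ij' ii']]]; apply: rev_ord_inj; rewrite -ij' -ii'.
Qed.

End Weights.

(** * Root spaces and the root space decomposition *)

Section RootSpaces.
Context (R : realType) (G : classical_group).
Local Notation C := R[i].
Local Notation N := (mxdim G).
Local Notation glie := (glie R G).
Local Notation cartan := (cartan R G).
Local Notation cartan_dual := (cartan_dual R G).
Local Notation loop := (loop R G).
Local Notation laurent := (laurent R).
Implicit Types (X Y : glie) (H : cartan) (i j : 'I_N).
Implicit Types alpha beta : cartan_dual.

Lemma entryP X Y : (forall i j, vsval X i j = vsval Y i j) -> X = Y.
Proof. by move=> XY; apply/val_inj/matrixP. Qed.

Lemma entryD X Y i j : vsval (X + Y) i j = vsval X i j + vsval Y i j.
Proof. by rewrite -[vsval (X + Y)]/(vsval X + vsval Y) mxE. Qed.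

Lemma entry0 i j : vsval (0 : glie) i j = 0.
Proof. by rewrite -[vsval 0]/(0 : 'M_N) mxE. Qed.

Lemma entry_neq0 X : X != 0 -> exists i j, vsval X i j != 0.
Proof.
move=> X0; apply: contraPP (X0) => nX; apply/negP; rewrite negbK.
apply/eqP/entryP => i j; rewrite entry0; apply/eqP.
by apply: contra_notT nX => Xij; exists i, j.
Qed.

Lemma root_neq0 alpha : alpha != 0 -> exists H, alpha H != 0.
Proof.
move=> alpha0; apply: contraPP (alpha0) => nH; apply/negP; rewrite negbK.
apply/eqP/lfunP => H; rewrite lfunE; apply/eqP.
by apply: contra_notT nH => alphaH; exists H.
Qed.

Lemma bracketDr X Y Z : bracket X (Y + Z) = bracket X Y + bracket X Z.
Proof. exact: linearD. Qed.
Lemma bracketDl X Y Z : bracket (X + Y) Z = bracket X Z + bracket Y Z.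
Proof. by rewrite ![bracket _ Z]bracketC bracketDr opprD. Qed.
Lemma bracketZr a X Y : bracket X (a *: Y) = a *: bracket X Y.
Proof. exact: linearZ. Qed.
Lemma bracketZl a X Y : bracket (a *: X) Y = a *: bracket X Y.
Proof. by rewrite ![bracket _ Y]bracketC bracketZr scalerN. Qed.

Lemma jacobi X Y Z :
  bracket (bracket X Y) Z = bracket X (bracket Y Z) - bracket Y (bracket X Z).
Proof.
apply: val_inj; rewrite -[val (_ - _)]/(val _ - val _) /= !val_bracket.
rewrite !(mulmxBl, mulmxBr) !mulmxA.
move: (vsval X) (vsval Y) (vsval Z) => A B D.
move: (A *m B *m D) (A *m D *m B) (B *m A *m D) (B *m D *m A) (D *m A *m B).
move: (D *m B *m A) => M1 M2 M3 M4 M5 M6.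
by apply/matrixP => i j; rewrite !mxE; ring.
Qed.

Lemma in_root_spaceD alpha X Y : in_root_space alpha X ->
  in_root_space alpha Y -> in_root_space alpha (X + Y).
Proof. by move=> Xa Ya H; rewrite bracketDr Xa Ya scalerDr. Qed.

Lemma in_root_spaceZ alpha a X :
  in_root_space alpha X -> in_root_space alpha (a *: X).
Proof. by move=> Xa H; rewrite bracketZr Xa scalerA mulrC -scalerA. Qed.

Lemma cartan_root_space0 H : in_root_space 0 (vsval H).
Proof.
move=> H'; apply: entryP => i j; rewrite bracket_cartan lfunE scale0r entry0.
have [->|ij] := eqVneq i j; first by rewrite subrr mul0r.
by rewrite (cartan_diag H) ?mulr0.
Qed.

(** Off-diagonal positions have nonzero weight, so h is its own centralizer. *)
Lemma root_space0_cartan X : in_root_space 0 X -> exists H, X = vsval H.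
Proof.
move=> X0; have Xh : X \in cartan_sub R G.
  rewrite mem_cartan_sub; apply/is_diag_mxP => i j ij; apply/eqP.
  apply: contraT => /(root_space_entry X0)/eqP.
  by rewrite (negPf (@weight_neq0 R G i j ij)).
by exists (vsproj (cartan_sub R G) X); rewrite vsprojK.
Qed.

(** Subtracting from [Y] the multiple of [X] with the same entry at [(i, j)] leaves a vector [Z] of
    weight [alpha]. By [weight_inj] it could be nonzero only at [(i, j)] or its mirror image, and
    the skew relation excludes the latter. *)
Lemma root_space_line alpha X Y : alpha != 0 -> X != 0 ->
  in_root_space alpha X -> in_root_space alpha Y -> exists a, Y = a *: X.
Proof.
move=> alpha0 X0 Xa Ya.
have [i [j Xij]] := entry_neq0 X0.
have wij := root_space_entry Xa Xij.
have ij : i != j by apply: contra_neq alpha0 => eij; rewrite -wij eij weightii.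
pose a := vsval Y i j / vsval X i j; exists a; apply/eqP.
rewrite -subr_eq0 -scaleNr; apply/eqP; set Z := _ + _.
have Za : in_root_space alpha Z.
  by apply: in_root_spaceD => //; apply: in_root_spaceZ.
have Zij : vsval Z i j = 0 by rewrite entryD entryZ mulNr divfK ?subrr.
apply: entryP => k l; rewrite entry0; apply/eqP; apply: contraT => Zkl.
have := root_space_entry Za Zkl; rewrite -wij => /esym /(weight_inj ij).
case=> [[kE lE]|[nSL [kE lE]]]; first by rewrite kE lE Zij eqxx in Zkl.
by rewrite skew_entry // kE lE !rev_ordK Zij mulr0 eqxx in Zkl.
Qed.

(** The root space decomposition as an induction principle for additive properties. *)
Lemma glie_ind (P : glie -> Prop) :
    P 0 -> (forall X Y, P X -> P Y -> P (X + Y)) -> (forall H, P (vsval H)) ->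
    (forall alpha X, is_root alpha -> in_root_space alpha X -> P X) ->
  forall X, P X.
Proof.
move=> P0 PD Ph Proot X; rewrite (sum_components X).
apply: (big_ind P) => // alpha _; have Xa := component_root_space alpha X.
have [alpha0|alpha0] := eqVneq alpha 0.
  by rewrite alpha0 in Xa *; have [H ->] := root_space0_cartan Xa.
have [-> //|X0] := eqVneq (component alpha X) 0.
by apply: (Proot alpha) => //; split=> //; exists (component alpha X).
Qed.

Lemma bracket_root_space alpha beta X Y : in_root_space alpha X ->
  in_root_space beta Y -> in_root_space (alpha + beta) (bracket X Y).
Proof.
move=> Xa Yb H; rewrite add_lfunE scalerDl -bracketZl -Xa -bracketZr -Yb.
by rewrite jacobi subrK.
Qed.

End RootSpaces.

(** * Biadditivity of the Cauchy product *)

Section ConvBilinear.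
Context (K : numDomainType) (U V W : zmodType) (op : U -> V -> W).
Implicit Types (x : series K U) (y : series K V).
Hypothesis opDl : forall u u' v, op (u + u') v = op u v + op u' v.
Hypothesis opDr : forall u v v', op u (v + v') = op u v + op u v'.

Let op0l v : op 0 v = 0.
Proof. by apply: (addrI (op 0 v)); rewrite -opDl !addr0. Qed.

Let op0r u : op u 0 = 0.
Proof. by apply: (addrI (op u 0)); rewrite -opDr !addr0. Qed.

Let summand_supp x y k i : op (x i) (y (k - i)) != 0 ->
  x i != 0 /\ y (k - i) != 0.
Proof. by move=> xy; split; apply: contra_neq xy => ->. Qed.

(** A sum with infinite support is 0 by convention, so additivity relies on a finite set [D]
    containing both supports. *)
Lemma fsum_split (I : choiceType) (D : set I) (f g : I -> W) :
    finite_set D -> (forall i, f i != 0 -> D i) ->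
    (forall i, g i != 0 -> D i) ->
  \sum_(i \in [set: I]) (f i + g i) =
  \sum_(i \in [set: I]) f i + \sum_(i \in [set: I]) g i.
Proof.
move=> Dfin fD gD.
have out (h : I -> W) i : (forall i, h i != 0 -> D i) -> ~ D i -> h i = 0.
  by move=> hD nDi; apply/eqP; apply: contra_notT nDi => /hD.
rewrite -3?(fsbig_widen D setT) //=; first by rewrite -fsbig_split.
- by move=> i [_ nDi] /=; exact: (out g).
- by move=> i [_ nDi] /=; exact: (out f).
- by move=> i [_ nDi] /=; rewrite (out f) // (out g) // addr0.
Qed.

Lemma convDl x x' y : conv op (x + x') y = conv op x y + conv op x' y.
Proof.
apply: series_ext => k; rewrite Defs.coefD !coef_conv //.
have fin : finite_set ([set i | x i != 0 /\ y (k - i) != 0] `|`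
    [set i | x' i != 0 /\ y (k - i) != 0])%classic.
  by rewrite finite_setU; split; apply: finite_conv_supp.
rewrite -(fsum_split fin); last 2 first.
- by move=> i /summand_supp ?; left.
- by move=> i /summand_supp ?; right.
by apply: eq_fsbigr => i _; rewrite opDl.
Qed.

Lemma convDr x y y' : conv op x (y + y') = conv op x y + conv op x y'.
Proof.
apply: series_ext => k; rewrite Defs.coefD !coef_conv //.
have fin : finite_set ([set i | x i != 0 /\ y (k - i) != 0] `|`
    [set i | x i != 0 /\ y' (k - i) != 0])%classic.
  by rewrite finite_setU; split; apply: finite_conv_supp.
rewrite -(fsum_split fin); last 2 first.
- by move=> i /summand_supp ?; left.
- by move=> i /summand_supp ?; right.
by apply: eq_fsbigr => i _; rewrite opDr.
Qed.

End ConvBilinear.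

(** * Series as finite sums of elements X (x) f *)

Section TensTheory.
Context (K : numDomainType) (F : idomainType) (V : lmodType F).
Implicit Types (X Y : V) (f g : series K F).

Lemma tens0l f : tens (0 : V) f = 0.
Proof. by apply: series_ext => k /=; rewrite scaler0. Qed.

Lemma tensDl X Y f : tens (X + Y) f = tens X f + tens Y f.
Proof. by apply: series_ext => k; rewrite Defs.coefD /= scalerDr. Qed.

Lemma tensZl a X f : tens (a *: X) f = a *: tens X f.
Proof. by apply: series_ext => k; rewrite Defs.coefZ /= !scalerA mulrC. Qed.

End TensTheory.

Lemma series_sumE (K : numDomainType) (V : zmodType) (I : Type) (r : seq I)
    (x : I -> series K V) (k : K) : (\sum_(i <- r) x i) k = \sum_(i <- r) x i k.
Proof. by elim/big_rec2: _ => // i _ y _ <-; rewrite Defs.coefD. Qed.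

Section Coordinates.
Context (K : numDomainType) (F : fieldType) (V : vectType F).

Lemma well_supported_coord n (b : n.-tuple V) i (x : series K V) :
  well_supported (fun k => coord b i (x k)).
Proof.
case: (coefP x) => s sP; exists s => k xk; apply: sP.
by apply: contra_neq xk => ->; rewrite linear0.
Qed.

(** As [V] has finite dimension, taking coordinates in a basis makes a vector-valued series a finite
    sum of pure tensors. *)
Lemma sum_tens (x : series K V) :
  x = \sum_(i < \dim {:V}) tens (vbasis {:V})`_i
        (Series (well_supported_coord (vbasis {:V}) i x)).
Proof.
apply: series_ext => k; rewrite series_sumE {1}(coord_vbasis (memvf (x k))).
by [].
Qed.

End Coordinates.

(** * The automorphism phi_mu of the loop algebra *)

Section LoopShift.
Context (R : realType) (G : classical_group).
Local Notation C := R[i].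
Local Notation N := (mxdim G).
Local Notation glie := (glie R G).
Local Notation cartan := (cartan R G).
Local Notation cartan_dual := (cartan_dual R G).
Local Notation loop := (loop R G).
Local Notation laurent := (laurent R).
Local Notation weight := (weight R).
Implicit Types (X Y : glie) (H mu : cartan) (i j : 'I_N).
Implicit Types (alpha beta : cartan_dual) (x y : loop) (f g : laurent).

Lemma loop_ind (P : loop -> Prop) :
    P 0 -> (forall x y, P x -> P y -> P (x + y)) ->
    (forall H f, P (tens (vsval H) f)) ->
    (forall alpha X f, is_root alpha -> in_root_space alpha X ->
       P (tens X f)) ->
  forall x, P x.
Proof.
move=> P0 PD Ph Proot x; rewrite (sum_tens x); apply: (big_ind P) => // b _.
move: (vbasis _)`_b (Series _) => X f; elim/glie_ind: X => [|X Y PX PY|H|].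
- by rewrite tens0l.
- by rewrite tensDl; apply: PD.
- exact: Ph.
- by move=> alpha X; apply: Proot.
Qed.

(** Treats h as the root space of weight 0, so that h and the root vectors need no separate
    cases. *)
Lemma loop_coweight_ind mu (P : loop -> Prop) : in_coweight_lattice mu ->
    P 0 -> (forall x y, P x -> P y -> P (x + y)) ->
    (forall alpha n X f, in_root_space alpha X -> alpha mu = n%:~R ->
       P (tens X f)) ->
  forall x, P x.
Proof.
move=> muP P0 PD PX; apply: loop_ind => // [H f|alpha X f root_alpha Xa].
  by apply: (PX 0 0) (cartan_root_space0 H) _; rewrite lfunE.
by have [n alphamu] := muP _ root_alpha; apply: (PX alpha n).
Qed.

(** The component of [X] of this weight is nonzero, so the weight is 0 or a root. *)
Lemma weight_coweight mu X i j : in_coweight_lattice mu ->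
  vsval X i j != 0 -> exists n : int, weight i j mu = n%:~R.
Proof.
move=> muP Xij; have [->|w0] := eqVneq (weight i j) 0.
  by exists 0; rewrite lfunE.
apply: muP; split=> //; exists (component (weight i j) X).
  apply: contra_neq Xij => Z0; have := componentE (weight i j) X i j.
  by rewrite Z0 entry0 eqxx mulr1n.
exact: component_root_space.
Qed.

(* The integer [alpha mu], with junk value 0 when [alpha mu] is not one. *)
Definition shift mu alpha : int :=
  if pselect (exists n : int, alpha mu = n%:~R) is left ex_n
  then sval (cid ex_n) else 0.

Lemma shiftE mu alpha (n : int) : alpha mu = n%:~R -> shift mu alpha = n.
Proof.
move=> alphamu; rewrite /shift; case: pselect => [ex_n|[]]; last by exists n.
by case: cid => m /=; rewrite alphamu => /intr_inj.
Qed.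

(** There are finitely many weights, hence finitely many translates of the support of [x]. *)
Lemma well_supported_loop_shift mu x :
  well_supported (fun k => glue (fun alpha => x (k - shift mu alpha))).
Proof.
case: (coefP x) => s sP.
exists [seq a + shift mu alpha | a <- s, alpha <- weights R G] => k.
set X := glue _ => X0.
have [i [j Xij]] := entry_neq0 X0.
have /sP[a a_s [n kn]] : x (k - shift mu (weight i j)) != 0.
  by apply: contra_neq Xij; rewrite glueE => ->; rewrite entry0.
exists (a + shift mu (weight i j)).
  apply: allpairs_f => //; rewrite mem_undup.
  by apply/mapP; exists (i, j); rewrite ?mem_enum.
by exists n; rewrite addrAC -kn subrK.
Qed.

(** This is phi_mu, given on coefficients: the entry at [(i, j)] is multiplied by xi to the power
    [shift mu (weight i j)]. *)
Definition loop_shift mu x : loop := Series (well_supported_loop_shift mu x).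

Lemma loop_shift_entry mu x k i j : vsval (loop_shift mu x k) i j =
  vsval (x (k - shift mu (weight i j))) i j.
Proof. exact: glueE. Qed.

Lemma loop_shift_linear mu : linear (loop_shift mu).
Proof.
move=> a x y; apply: series_ext => k; apply: entryP => i j.
rewrite Defs.coefD Defs.coefZ entryD entryZ !loop_shift_entry.
by rewrite Defs.coefD Defs.coefZ entryD entryZ.
Qed.

Lemma loop_shiftD mu x y :
  loop_shift mu (x + y) = loop_shift mu x + loop_shift mu y.
Proof. by have := loop_shift_linear mu 1 x y; rewrite !scale1r. Qed.

Lemma loop_shift0 mu : loop_shift mu 0 = 0.
Proof. by apply: (addrI (loop_shift mu 0)); rewrite -loop_shiftD !addr0. Qed.

Lemma coef_xiM n f k : (xi R n * f) k = f (k - n).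
Proof. by rewrite [LHS]coef_monoM mul1r. Qed.

Lemma xiM m n : xi R m * xi R n = xi R (m + n).
Proof. by rewrite [LHS]monoM mulr1. Qed.

Lemma loop_shift_tens mu alpha X (n : int) f :
    in_root_space alpha X -> alpha mu = n%:~R ->
  loop_shift mu (tens X f) = tens X (xi R n * f).
Proof.
move=> Xa alphamu; apply: series_ext => k; apply: entryP => i j.
rewrite loop_shift_entry /= !entryZ coef_xiM.
have [->|Xij] := eqVneq (vsval X i j) 0; first by rewrite !mulr0.
by rewrite (root_space_entry Xa Xij) (shiftE alphamu).
Qed.

Lemma loop_bracketDl x x' y :
  loop_bracket (x + x') y = loop_bracket x y + loop_bracket x' y.
Proof. by apply: convDl; [exact: bracketDl | exact: bracketDr]. Qed.

Lemma loop_bracketDr x y y' :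
  loop_bracket x (y + y') = loop_bracket x y + loop_bracket x y'.
Proof. by apply: convDr; [exact: bracketDl | exact: bracketDr]. Qed.

Lemma biadditive_loop_eq (W : zmodType) mu (A B : loop -> loop -> W) :
    in_coweight_lattice mu ->
    (forall x x' y, A (x + x') y = A x y + A x' y) ->
    (forall x y y', A x (y + y') = A x y + A x y') ->
    (forall x x' y, B (x + x') y = B x y + B x' y) ->
    (forall x y y', B x (y + y') = B x y + B x y') ->
    (forall alpha beta m n X Y f g, in_root_space alpha X ->
      in_root_space beta Y -> alpha mu = m%:~R -> beta mu = n%:~R ->
      A (tens X f) (tens Y g) = B (tens X f) (tens Y g)) ->
  forall x y, A x y = B x y.
Proof.
move=> muP ADl ADr BDl BDr AB x y.
have A0l z : A 0 z = 0 by apply: (addrI (A 0 z)); rewrite -ADl !addr0.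
have A0r z : A z 0 = 0 by apply: (addrI (A z 0)); rewrite -ADr !addr0.
have B0l z : B 0 z = 0 by apply: (addrI (B 0 z)); rewrite -BDl !addr0.
have B0r z : B z 0 = 0 by apply: (addrI (B z 0)); rewrite -BDr !addr0.
move: x; apply: (loop_coweight_ind muP) => [|x x' IHx IHx'|alpha m X f Xa am].
- by rewrite A0l B0l.
- by rewrite ADl BDl IHx IHx'.
move: y; apply: (loop_coweight_ind muP) => [|y y' IHy IHy'|beta n Y g Yb bn].
- by rewrite A0r B0r.
- by rewrite ADr BDr IHy IHy'.
exact: AB am bn.
Qed.

(** Weights add under the bracket of weight vectors, just as exponents add under multiplication of
    powers of xi. *)
Lemma loop_shift_bracket mu x y : in_coweight_lattice mu ->
  loop_shift mu (loop_bracket x y) =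
  loop_bracket (loop_shift mu x) (loop_shift mu y).
Proof.
move=> muP; move: x y.
apply: (biadditive_loop_eq muP) => [x x' y|x y y'|x x' y|x y y'|].
- exact: etrans (congr1 _ (loop_bracketDl _ _ _)) (loop_shiftD _ _ _).
- exact: etrans (congr1 _ (loop_bracketDr _ _ _)) (loop_shiftD _ _ _).
- by rewrite (loop_shiftD mu x x'); exact: loop_bracketDl.
- by rewrite (loop_shiftD mu y y'); exact: loop_bracketDr.
move=> alpha beta m n X Y f g Xa Yb am bn.
rewrite loop_bracket_tens (loop_shift_tens _ Xa am) (loop_shift_tens _ Yb bn).
rewrite loop_bracket_tens (@loop_shift_tens _ (alpha + beta) _ (m + n)).
- by rewrite mulrACA xiM.
- exact: bracket_root_space.
- by rewrite lfunE /= am bn rmorphD.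
Qed.

Lemma coweightN mu : in_coweight_lattice mu -> in_coweight_lattice (- mu).
Proof.
move=> muP alpha /muP[n alphamu]; exists (- n).
by rewrite linearN /= alphamu rmorphN.
Qed.

(** The separate variable [nu] lets the lemma serve for both [mu] and [- mu]. *)
Lemma loop_shiftK mu nu : in_coweight_lattice mu -> nu = - mu ->
  cancel (loop_shift mu) (loop_shift nu).
Proof.
move=> muP ->.
apply: (loop_coweight_ind muP) => [|x y IHx IHy|alpha n X f Xa an].
- by rewrite !loop_shift0.
- by rewrite !loop_shiftD IHx IHy.
rewrite (loop_shift_tens _ Xa an) (@loop_shift_tens _ alpha _ (- n)) //.
  by rewrite mulrA xiM addNr mul1r.
by rewrite linearN /= an rmorphN.
Qed.

Lemma loop_shift_bij mu : in_coweight_lattice mu -> bijective (loop_shift mu).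
Proof.
move=> muP; exists (loop_shift (- mu)); first exact: loop_shiftK.
by apply: loop_shiftK; [exact: coweightN | rewrite opprK].
Qed.

End LoopShift.

(** * Invariance of the Killing form *)

Section InvariantForm.
Context (R : realType) (G : classical_group).
Local Notation C := R[i].
Local Notation glie := (glie R G).
Implicit Types X Y Z : glie.

Definition invariant_form (form : glie -> glie -> C) :=
  [/\ forall Z, linear (form^~ Z : glie -> C^o),
      forall Z, linear (form Z : glie -> C^o) &
      forall X Y Z, form (bracket X Y) Z = form X (bracket Y Z)].

Lemma lfun_trace_linear : linear (@lfun_trace R G : _ -> C^o).
Proof.
by move=> a f g; rewrite /lfun_trace passmx.mxof_linear mxtraceD mxtraceZ.
Qed.

Lemma lfun_traceB (f g : 'End(glie)) :
  lfun_trace (f - g) = lfun_trace f - lfun_trace g.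
Proof.
by rewrite -scaleN1r [_ + _ *: _]addrC lfun_trace_linear scaleN1r addrC.
Qed.

Lemma lfun_traceC (f g : 'End(glie)) :
  lfun_trace (f \o g)%VF = lfun_trace (g \o f)%VF.
Proof.
by rewrite /lfun_trace !(passmx.mxof_comp _ _ (vbasisP _)) mxtrace_mulC.
Qed.

Lemma ad_linear : linear (@ad R G).
Proof.
move=> a X Y; apply/lfunP => Z.
by rewrite add_lfunE scale_lfunE !lfunE /= bracketDl bracketZl.
Qed.

Lemma ad_bracket X Y : ad (bracket X Y) =
  (ad X \o ad Y)%VF - (ad Y \o ad X)%VF.
Proof.
by apply/lfunP => Z; rewrite add_lfunE opp_lfunE !comp_lfunE !lfunE /= jacobi.
Qed.

Lemma killing_linearl Z : linear (@killing R G ^~ Z : _ -> C^o).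
Proof.
move=> a X Y; rewrite /killing ad_linear comp_lfunDl -comp_lfunZl.
exact: lfun_trace_linear.
Qed.

Lemma killing_linearr Z : linear (killing Z : glie -> C^o).
Proof.
move=> a X Y; rewrite /killing ad_linear comp_lfunDr -comp_lfunZr.
exact: lfun_trace_linear.
Qed.

(** Both sides expand into traces of triple products of [ad X], [ad Y], [ad Z], which agree by
    cyclicity of the trace. *)
Lemma killing_bracket X Y Z : killing (bracket X Y) Z = killing X (bracket Y Z).
Proof.
rewrite /killing !ad_bracket comp_lfunDl comp_lfunDr comp_lfunNl comp_lfunNr.
have cycl : lfun_trace ((ad Y \o ad X) \o ad Z)%VF =
            lfun_trace (ad X \o (ad Z \o ad Y))%VF.
  by rewrite -comp_lfunA lfun_traceC -comp_lfunA.
rewrite (lfun_traceB ((ad X \o ad Y) \o ad Z)%VF).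
by rewrite (lfun_traceB (ad X \o (ad Y \o ad Z))%VF) cycl !comp_lfunA.
Qed.

Lemma normalized_invariant form : normalized_form form -> invariant_form form.
Proof.
case=> [[c formE] _]; split=> [Z a X Y|Z a X Y|X Y Z]; rewrite !formE.
- by rewrite killing_linearl mulrDr [c * _ in LHS]mulrCA.
- by rewrite killing_linearr mulrDr [c * _ in LHS]mulrCA.
- by rewrite killing_bracket.
Qed.

End InvariantForm.

(** * The cocycle identity and the automorphism sigma_mu *)

Section AffineShift.
Context (R : realType) (G : classical_group).
Local Notation C := R[i].
Local Notation glie := (glie R G).
Local Notation cartan := (cartan R G).
Local Notation cartan_dual := (cartan_dual R G).
Local Notation loop := (loop R G).
Local Notation affine := (affine R G).
Local Notation laurent := (laurent R).
Implicit Types (X Y : glie) (H mu : cartan).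
Implicit Types (alpha beta : cartan_dual) (x y : loop) (f g : laurent).

Variables (form : glie -> glie -> C) (form_inv : invariant_form form).

Lemma formDl X Y Z : form (X + Y) Z = form X Z + form Y Z.
Proof. by case: form_inv => + _ _ => /(_ Z 1 X Y); rewrite !scale1r. Qed.
Lemma formDr X Y Z : form X (Y + Z) = form X Y + form X Z.
Proof. by case: form_inv => _ + _ => /(_ X 1 Y Z); rewrite !scale1r. Qed.
Lemma form0l X : form 0 X = 0.
Proof. by apply: (addrI (form 0 X)); rewrite -formDl !addr0. Qed.
Lemma form0r X : form X 0 = 0.
Proof. by apply: (addrI (form X 0)); rewrite -formDr !addr0. Qed.
Lemma formZl a X Y : form (a *: X) Y = a * form X Y.
Proof.
by case: form_inv => + _ _ => /(_ Y a X 0); rewrite !addr0 form0l addr0.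
Qed.
Lemma formZr a X Y : form X (a *: Y) = a * form X Y.
Proof.
by case: form_inv => _ + _ => /(_ X a Y 0); rewrite !addr0 form0r addr0.
Qed.

Lemma form_bracket X Y Z : form (bracket X Y) Z = form X (bracket Y Z).
Proof. by case: form_inv. Qed.

(** Invariance gives [form [H, X] Y + form X [H, Y] = 0]. Hence root spaces are orthogonal unless
    their weights are opposite. *)
Lemma form_root_spaces alpha beta X Y H : in_root_space alpha X ->
  in_root_space beta Y -> (alpha H + beta H) * form X Y = 0.
Proof.
move=> Xa Yb; rewrite mulrDl -formZl -Xa bracketC -scaleN1r formZl.
by rewrite form_bracket Yb formZr mulN1r addNr.
Qed.

Lemma form_cartan_root alpha X H : is_root alpha -> in_root_space alpha X ->
  form (vsval H) X = 0.
Proof.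
move=> [/root_neq0[H' alphaH'] _] Xa.
have := form_root_spaces H' (cartan_root_space0 H) Xa.
by rewrite lfunE add0r => /eqP; rewrite mulf_eq0 (negPf alphaH') => /eqP.
Qed.

(** The coefficient of c in the affine bracket. *)
Definition cocycle x y : C := res (conv form (dser x) y).

Lemma dserD x y : dser (x + y) = dser x + dser y.
Proof. by apply: series_ext => k; rewrite Defs.coefD /= mulrzDl. Qed.

Lemma cocycleDl x x' y : cocycle (x + x') y = cocycle x y + cocycle x' y.
Proof. by rewrite /cocycle dserD (convDl formDl formDr). Qed.

Lemma cocycleDr x y y' : cocycle x (y + y') = cocycle x y + cocycle x y'.
Proof. by rewrite /cocycle (convDr formDl formDr). Qed.

Lemma cocycle_tens X Y f g :
  cocycle (tens X f) (tens Y g) = form X Y * res (g * dser f).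
Proof.
have := @affine_bracket_tens R G form X Y f g 0 0; move=> /(_ _)/(congr1 snd).
by apply=> u v c d; rewrite formZl formZr mulrA.
Qed.

Lemma coef_mulrz f n k : (f *~ n) k = f k *~ n.
Proof.
have coef_mulrn m : (f *+ m) k = f k *+ m.
  by elim: m => // m IHm; rewrite !mulrS Defs.coefD IHm.
by case: n => n; rewrite ?NegzE ?mulrNz ?Defs.coefN -!pmulrn coef_mulrn.
Qed.

(** The Leibniz rule, with n xi^(n-1) as the derivative of xi^n. *)
Lemma dser_xiM n f :
  dser (xi R n * f) = xi R n * dser f + (xi R (n - 1) * f) *~ n.
Proof.
apply: series_ext => k; rewrite Defs.coefD coef_mulrz /= !coef_xiM /=.
have -> : k + 1 - n = k - n + 1 by rewrite addrAC.
have -> : k - (n - 1) = k - n + 1 by rewrite opprB addrCA addrC.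
by rewrite -mulrzDr addrAC subrK.
Qed.

(** The shift changes the cocycle by the coboundary of the functional sending [x] to
    [form mu (x 0)]; adding this functional to the central component compensates for the change. *)
Lemma cocycle_shift mu x y : in_coweight_lattice mu ->
  cocycle (loop_shift mu x) (loop_shift mu y) =
  cocycle x y + form (vsval mu) (loop_bracket x y 0).
Proof.
move=> muP; move: x y.
apply: (biadditive_loop_eq muP) => [x x' y|x y y'|x x' y|x y y'|].
- by rewrite loop_shiftD cocycleDl.
- by rewrite loop_shiftD cocycleDr.
- by rewrite cocycleDl (loop_bracketDl x x') Defs.coefD formDr addrACA.
- by rewrite cocycleDr (loop_bracketDr _ y y') Defs.coefD formDr addrACA.
move=> alpha beta m n X Y f g Xa Yb am bn.
rewrite (loop_shift_tens _ Xa am) (loop_shift_tens _ Yb bn) !cocycle_tens.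
rewrite loop_bracket_tens /= formZr -form_bracket Xa formZl am.
(* By invariance [form mu [X, Y] = m * form X Y], and [form X Y] vanishes
   unless [m + n = 0]. *)
have [->|XY0] := eqVneq (form X Y) 0; first by rewrite !mul0r !mulr0 addr0.
have /eqP := form_root_spaces mu Xa Yb.
rewrite mulf_eq0 (negPf XY0) orbF am bn -rmorphD intr_eq0 addrC addr_eq0.
(* With [n = - m] the powers of xi cancel in the first Leibniz term, leaving the old cocycle; the
   second term carries the factor [m] and yields the correction. *)
move=> /eqP ->; rewrite dser_xiM mulrDr mulrzAr.
have -> : xi R (- m) * g * (xi R m * dser f) = g * dser f.
  by rewrite mulrACA xiM addNr mul1r.
have -> : xi R (- m) * g * (xi R (m - 1) * f) = xi R (-1) * (f * g).
  by rewrite mulrACA xiM addKr [g * f]mulrC.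
rewrite /res Defs.coefD coef_mulrz coef_xiM subrr mulrDr.
rewrite -[_ *~ m]mulrzr; congr (_ + _).
by rewrite mulrCA [_ * m%:~R]mulrC mulrCA.
Qed.

(** A closed form of sigma_mu: the residue of xi^-1 f dxi is the constant term of f, and since root
    vectors are orthogonal to h only the h-part of [u.1 0] contributes to the central term. *)
Definition affine_shift mu (u : affine) : affine :=
  (loop_shift mu u.1, u.2 + form (vsval mu) (u.1 0)).

Lemma affine_shift_linear mu : linear (affine_shift mu).
Proof.
move=> a [x b] [y d]; rewrite /affine_shift /=; congr (_, _).
  exact: loop_shift_linear.
rewrite -[X in form _ X]/(a *: x 0 + y 0) formDr formZr.
by rewrite addrACA -mulrDr.
Qed.

Lemma affine_shift_bij mu :
  in_coweight_lattice mu -> bijective (affine_shift mu).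
Proof.
move=> /loop_shift_bij[psi psiK Kpsi].
exists (fun u => (psi u.1, u.2 - form (vsval mu) (psi u.1 0))) => -[x a].
  by rewrite /affine_shift /= psiK addrK.
by rewrite /affine_shift /= Kpsi subrK.
Qed.

Lemma affine_shift_bracket mu (u v : affine) : in_coweight_lattice mu ->
  affine_shift mu (affine_bracket form u v) =
  affine_bracket form (affine_shift mu u) (affine_shift mu v).
Proof.
move=> muP; rewrite /affine_shift /affine_bracket /=; congr (_, _).
  exact: loop_shift_bracket.
exact: esym (cocycle_shift _ _ muP).
Qed.

Lemma affine_shift_single_shift Xr mu :
    (forall alpha, is_root alpha ->
       Xr alpha != 0 /\ in_root_space alpha (Xr alpha)) ->
  single_shift form Xr mu (affine_shift mu).
Proof.
move=> XrP; split; first exact: affine_shift_linear.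
- by rewrite /affine_shift /= loop_shift0 form0r addr0.
- move=> H f; rewrite /affine_shift /=.
  rewrite (@loop_shift_tens _ _ mu 0 _ 0 _ (cartan_root_space0 H)) ?lfunE //.
  by rewrite mul1r add0r formZr mulrC /res coef_xiM subrr.
- move=> alpha n f root_alpha alphamu; have [_ Xra] := XrP _ root_alpha.
  rewrite /affine_shift /= (loop_shift_tens _ Xra alphamu) add0r formZr.
  by rewrite (form_cartan_root mu root_alpha Xra) mulr0.
Qed.

End AffineShift.

(** * The Lie algebra g is perfect *)

Section Perfect.
Context (R : realType) (G : classical_group).
Local Notation C := R[i].
Local Notation N := (mxdim G).
Local Notation glie := (glie R G).
Local Notation cartan := (cartan R G).
Implicit Types (X Y : glie) (H : cartan) (a b i j : 'I_N).

(** The projection [vsproj] returns [diag_delta a b] itself when this matrix lies in g, as in all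
    uses below. *)
Definition coroot a b : glie := vsproj (lie_sub R G) (diag_delta R a b).

(** A matrix unit made skew for the symmetric antidiagonal form; off the diagonal and the
    antidiagonal these are root vectors of so_n. *)
Definition skew_unit i j : 'M[C]_N :=
  delta_mx i j - delta_mx (rev_ord j) (rev_ord i).

Lemma rev_eq i j : (rev_ord i == j) = (i == rev_ord j).
Proof. exact: can2_eq (@rev_ordK _) (@rev_ordK _) _ _. Qed.

(** Separates so_n from sp_2n. For so_n the bound on [N] provides an index other than [a] and
    [rev_ord a]. *)
Lemma form_sign_cases : simple_group G -> ~~ is_SL G ->
  (2 < N)%N /\ (forall a, form_sign a = false) \/
  forall a, form_sign (rev_ord a) = ~~ form_sign a.
Proof.
case: (G) => [n|n|n] //= simpleG _; first by left; split=> //; lia.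
by right=> a; have := ltn_ord a; rewrite /=; lia.
Qed.

Variable l : glie -> C.
Hypothesis l_linear : linear (l : glie -> C^o).
Hypothesis l_bracket : forall X Y, l (bracket X Y) = 0.

Let lD X Y : l (X + Y) = l X + l Y.
Proof. by have := l_linear 1 X Y; rewrite !scale1r. Qed.

Let l0 : l 0 = 0.
Proof. by apply: (addrI (l 0)); rewrite -lD !addr0. Qed.

Let lZ c X : l (c *: X) = c * l X.
Proof. by have := l_linear c X 0; rewrite l0 !addr0. Qed.

Let l_commutator (A B : 'M[C]_N) : A \in lie_sub R G -> B \in lie_sub R G ->
  l (vsproj (lie_sub R G) (A *m B - B *m A)) = 0.
Proof.
move=> Ag Bg; have := l_bracket (vsproj _ A) (vsproj _ B).
by rewrite /bracket !vsprojK.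
Qed.

Lemma skew_unit_sub i j : ~~ is_SL G -> (forall a, form_sign a = false) ->
  skew_unit i j \in lie_sub R G.
Proof.
move=> nSL e0; apply/(mem_lie_sub_skew _ nSL) => k m.
rewrite !e0 !mxE !rev_eq !rev_ordK mulN1r opprB.
by rewrite ![(m == _) && _]andbC.
Qed.

Lemma skew_unit_commutator i j : j != rev_ord i ->
  skew_unit i j *m skew_unit j i - skew_unit j i *m skew_unit i j =
  diag_delta R i (rev_ord i) - diag_delta R j (rev_ord j).
Proof.
move=> /negPf ji; rewrite /skew_unit /diag_delta !(mulmxBl, mulmxBr).
have ij : i == rev_ord j = false by rewrite -rev_eq eq_sym.
rewrite !mul_delta_mx_cond !eqxx !rev_eq ij ji !mulr0n !mulr1n.
by apply/matrixP => k m; rewrite !mxE; ring.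
Qed.

(** E_aa - E_bb is the commutator of E_ab and E_ba. *)
Lemma l_coroot_SL a b : is_SL G -> l (coroot a b) = 0.
Proof.
move=> SLG; have [->|ab] := eqVneq a b.
  by rewrite /coroot /diag_delta subrr linear0.
have unit_sub (i j : 'I_N) : i != j -> delta_mx i j \in lie_sub R G.
  move: SLG i j; clear; case: (G) => // n _ i j ij.
  rewrite mem_lie_sub -(mul_delta_mx i) mxtrace_mulC.
  by rewrite mul_delta_mx_0 ?mxtrace0 // eq_sym.
rewrite /coroot /diag_delta -(mul_delta_mx b a a) -(mul_delta_mx a b b).
by apply: l_commutator; apply: unit_sub; rewrite // eq_sym.
Qed.

(** With a' = [rev_ord a], in sp_2n the element is the commutator of E_aa' and E_a'a. In so_n those
    units are not in g, and commutators of skew units give differences of two such elements. *)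
Lemma l_coroot_rev a : simple_group G -> ~~ is_SL G ->
  l (coroot a (rev_ord a)) = 0.
Proof.
move=> simpleG nSL; case: (form_sign_cases simpleG nSL) => [[N2 e0]|e_rev].
  have [j ja ja'] : exists2 j, j != a & j != rev_ord a.
    have : (0 < #|~: [set a; rev_ord a]|)%N.
      rewrite cardsCs finset.setCK card_ord subn_gt0 cards2.
      by apply: leq_ltn_trans N2; case: (_ != _).
    by case/card_gt0P => j; rewrite !inE negb_or => /andP[ja ja']; exists j.
  (* Using both k and rev k, one finds l (coroot a) = l (coroot k) and
     l (coroot a) = - l (coroot k). *)
  have lB k : k != rev_ord a ->
      l (coroot a (rev_ord a)) = l (coroot k (rev_ord k)).
    move=> ka; have := skew_unit_sub k a nSL e0.
    move=> /(l_commutator (skew_unit_sub a k nSL e0)).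
    rewrite skew_unit_commutator // linearB /= -scaleN1r lD lZ mulN1r.
    by move/eqP; rewrite subr_eq0 => /eqP.
  have lj := lB j ja'.
  have := lB (rev_ord j); rewrite (inj_eq rev_ord_inj) => /(_ ja).
  have -> : coroot (rev_ord j) (rev_ord (rev_ord j)) =
      - 1 *: coroot j (rev_ord j).
    by rewrite scaleN1r rev_ordK /coroot /diag_delta -linearN opprB.
  rewrite lZ -lj mulN1r => /eqP; rewrite -subr_eq0 opprK -mulr2n mulrn_eq0 /=.
  by move/eqP.
have unit_sub i : delta_mx i (rev_ord i) \in lie_sub R G.
  apply/(mem_lie_sub_skew _ nSL) => k m; rewrite !mxE !rev_eq !rev_ordK andbC.
  have [/andP[/eqP -> /eqP ->]|] := boolP (_ && _); last by rewrite mulr0.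
  by rewrite e_rev; case: (form_sign _); rewrite /= expr1 opprK mulr1.
have := l_commutator (unit_sub a) (unit_sub (rev_ord a)).
by rewrite rev_ordK !mul_delta_mx.
Qed.

(** The equality [g, g] = g in dual form: a linear functional vanishing on all brackets is zero. *)
Lemma perfect X : simple_group G -> l X = 0.
Proof.
move=> simpleG; elim/glie_ind: X => [|X Y lX lY|H|alpha X [alpha0 _] Xa].
- exact: l0.
- by rewrite lD lX lY addr0.
- have D i j : i != j -> vsval (vsval H) i j = 0 by apply: cartan_diag.
  have sumE (c : 'I_N -> C) (b : 'I_N -> 'I_N) :
      (forall i, is_SL G || (b i == rev_ord i)) ->
      vsval H = \sum_i c i *: coroot i (b i) -> l (vsval H) = 0.
    move=> bP ->; apply: (big_ind (fun X => l X = 0)) => [|Y Z lY0 lZ0|i _].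
    + exact: l0.
    + by rewrite lD lY0 lZ0 addr0.
    rewrite lZ; have [SLG|nSL] := boolP (is_SL G).
      by rewrite l_coroot_SL ?mulr0.
    have := bP i; rewrite (negPf nSL) => /eqP ->.
    by rewrite l_coroot_rev ?mulr0.
  have entry_sum (c : 'I_N -> C) (b : 'I_N -> 'I_N) j k :
      (forall i, is_SL G || (b i == rev_ord i)) ->
      vsval (\sum_i c i *: coroot i (b i)) j k =
      c j *+ (j == k) - \sum_i c i * ((j == b i) && (k == b i))%:R.
    move=> bP; rewrite linear_sum summxE.
    rewrite [LHS](eq_bigr (fun i => c i * ((j == i) && (k == i))%:R -
        c i * ((j == b i) && (k == b i))%:R)) => [|i _].
      rewrite sumrB; congr (_ - _); rewrite (bigD1 j) //= eqxx eq_sym big1.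
        by rewrite addr0 mulr_natr.
      by move=> i; rewrite eq_sym => /negPf ->; rewrite mulr0.
    by rewrite entryZ vsprojK ?diag_delta_sub // !mxE mulrBr.
  have [SLG|nSL] := boolP (is_SL G).
    (* For sl_n any index [a0] can be fixed: as the trace of H is 0, H is the sum over i of H_ii
       (E_ii - E_a0a0). *)
    have [a0 _|N0] := pickP (mem 'I_N); last first.
      rewrite (_ : vsval H = 0) ?l0 //; apply: entryP => i.
      by have := N0 i.
    apply: (sumE (fun i => vsval (vsval H) i i) (fun=> a0)) => [i|].
      by rewrite SLG.
    apply: entryP => j k; rewrite entry_sum => [|i]; last by rewrite SLG.
    rewrite -mulr_suml (_ : \sum_i _ = 0) ?mul0r ?subr0; last first.
      apply/eqP; move: SLG (subvsP (vsval H)); move: (vsval (vsval H)); clear.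
      by case: (G) => // n A _; rewrite mem_lie_sub.
    by have [->|/D ->] := eqVneq j k; rewrite ?mulr1n ?mulr0n.
  (* In so_n and sp_2n the diagonal of H is antisymmetric under reversal, so [i] and [rev_ord i]
     contribute the same term; hence the division by 2. *)
  apply: (sumE (fun i => vsval (vsval H) i i / 2) (@rev_ord N)) => [i|].
    by rewrite eqxx orbT.
  apply: entryP => j k; rewrite entry_sum => [|i]; last by rewrite eqxx orbT.
  rewrite (bigD1 (rev_ord j)) //= big1 ?addr0 => [|i]; last first.
    by rewrite eq_sym rev_eq => /negPf ->; rewrite mulr0.
  rewrite rev_ordK eqxx cartan_rev // eq_sym.
  have [->|/D ->] := eqVneq j k; rewrite ?mulr1n ?mulr0n ?mulr0 ?subr0 //.
  by rewrite mulr1 mulNr opprK -splitr.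
(* A root vector X is a multiple of [H, X] as soon as alpha(H) is nonzero. *)
have [H alphaH] := root_neq0 alpha0.
have := l_bracket (vsval H) X; rewrite Xa lZ => /eqP.
by rewrite mulf_eq0 (negPf alphaH) => /eqP.
Qed.

End Perfect.

(** * Uniqueness of the single shift and of the extension *)

Section Uniqueness.
Context (R : realType) (G : classical_group).
Local Notation C := R[i].
Local Notation glie := (glie R G).
Local Notation cartan := (cartan R G).
Local Notation loop := (loop R G).
Local Notation affine := (affine R G).
Implicit Types (X Y : glie) (mu : cartan) (x y : loop).
Variable form : glie -> glie -> C.

Lemma linear_funD (U V : lmodType C) (h : U -> V) u v :
  linear h -> h (u + v) = h u + h v.
Proof. by move=> /(_ 1 u v); rewrite !scale1r. Qed.

Lemma linear_fun0 (U V : lmodType C) (h : U -> V) : linear h -> h 0 = 0.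
Proof. by move=> /(_ (-1) 0 0); rewrite !scaleN1r !addNr. Qed.

Lemma linear_funZ (U V : lmodType C) (h : U -> V) a u :
  linear h -> h (a *: u) = a *: h u.
Proof.
by move=> h_lin; have := h_lin a u 0; rewrite !addr0 linear_fun0 ?addr0.
Qed.

Lemma affine_split x (a : C^o) :
  ((x, a) : affine) = ((x, 0) : affine) + a *: central R G.
Proof.
by congr (_, _); rewrite /= ?scaler0 ?addr0 // add0r; exact: esym (mulr1 a).
Qed.

(** Root spaces are lines, so the elements H (x) f and X_alpha (x) f, together with c, span the
    affine algebra. *)
Lemma single_shift_unique Xr mu (sigma tau : affine -> affine) :
    (forall alpha, is_root alpha ->
       Xr alpha != 0 /\ in_root_space alpha (Xr alpha)) ->
    in_coweight_lattice mu ->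
    single_shift form Xr mu sigma -> single_shift form Xr mu tau ->
  sigma =1 tau.
Proof.
move=> XrP muP [s_lin sc sH sX] [t_lin tc tH tX] [x a]; rewrite affine_split.
rewrite (linear_funD _ _ s_lin) (linear_funD _ _ t_lin).
rewrite (linear_funZ _ _ s_lin) (linear_funZ _ _ t_lin) sc tc; congr (_ + _).
elim/loop_ind: x => [|x y IHx IHy|H f|alpha X f root_alpha Xa].
- by rewrite (linear_fun0 s_lin) (linear_fun0 t_lin).
- have -> : ((x + y, 0) : affine) = ((x, 0) : affine) + ((y, 0) : affine).
    by congr (_, _); rewrite addr0.
  by rewrite (linear_funD _ _ s_lin) (linear_funD _ _ t_lin) IHx IHy.
- by rewrite sH tH.
have [Xr0 Xra] := XrP _ root_alpha; have [alpha0 _] := root_alpha.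
have [b ->] := root_space_line alpha0 Xr0 Xra Xa; rewrite tensZl.
have -> : ((b *: tens (Xr alpha) f, 0) : affine) =
    b *: ((tens (Xr alpha) f, 0) : affine).
  by congr (_, _); rewrite scaler0.
have [n alphamu] := muP _ root_alpha.
by rewrite (linear_funZ _ _ s_lin) (linear_funZ _ _ t_lin) (sX _ n) // (tX _ n).
Qed.

(** The loop components agree by [induces], so the difference of the two maps is the functional [l]
    with values in the center. *)
Lemma extension_unique (phi : loop -> loop) (psi sigma : affine -> affine) :
    simple_group G -> normalized_form form ->
    lie_automorphism (affine_bracket form) psi ->
    lie_automorphism (affine_bracket form) sigma ->
    induces psi phi -> induces sigma phi ->
  psi =1 sigma.
Proof.
move=> simpleG formN [p_lin _ p_br] [s_lin _ s_br] p_phi s_phi.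
have form_inv := normalized_invariant formN.
pose l (u : affine) : C^o := (psi u).2 - (sigma u).2.
have l_lin : linear l.
  move=> a u v; rewrite /l p_lin s_lin /= scalerBr opprD addrACA.
  by [].
(* The bracket of two images depends only on their loop components, which are the same for both
   maps. *)
have l_br u v : l (affine_bracket form u v) = 0.
  by rewrite /l p_br s_br /affine_bracket /= !p_phi !s_phi subrr.
suff l0 u : l u = 0.
  move=> u; rewrite [psi u]surjective_pairing [sigma u]surjective_pairing.
  by rewrite p_phi s_phi; congr (_, _); apply/eqP; rewrite -subr_eq0 -/(l u) l0.
have formZZ u' v' c d : form (c *: u') (d *: v') = c * d * form u' v'.
  by rewrite (formZl form_inv) (formZr form_inv) mulrA.
have lx x : l (x, 0) = 0.
  rewrite (sum_tens x).
  have l_add : forall y z, l (y + z, 0) = l (y, 0) + l (z, 0).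
    move=> y z; rewrite -(linear_funD _ _ l_lin); congr l.
    by congr (_, _); rewrite addr0.
  apply: (big_ind (fun y => l (y, 0) = 0)) => [|y z ly lz|b _].
  - exact: linear_fun0 l_lin.
  - by rewrite l_add ly lz addr0.
  move: (Series _) (vbasis _)`_b => f X.
  apply: (perfect (l := fun X => l (tens X f, 0))) simpleG => [a Y Z|Y Z].
    rewrite tensDl tensZl l_add; congr (_ + _).
    rewrite -(linear_funZ _ _ l_lin).
    by congr l; congr (_, _); rewrite scaler0.
  (* Pairing with the constant loop Y (x) 1, whose derivative is zero, gives a bracket without
     central term. *)
  have := l_br (tens Y (xi R 0), 0) (tens Z f, 0).
  rewrite affine_bracket_tens // mul1r.
  suff -> : dser (xi R 0) = 0 by rewrite mulr0 mulr0.
  apply: series_ext => k /=; case: eqP => [->|]; first by rewrite mulr0z.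
  by rewrite mul0rz.
case: u => x a; rewrite affine_split (linear_funD _ _ l_lin) lx add0r.
rewrite (linear_funZ _ _ l_lin).
(* The bracket of t (x) xi and t (x) xi^-1 has central part <t, t> c = 2c. As [lx] kills its loop
   part, [l] vanishes at c. *)
have [_ [theta [t [_ _ tt _]]]] := formN.
have := l_br (tens (vsval t) (xi R 1), 0) (tens (vsval t) (xi R (-1)), 0).
have res1 : res (xi R (-1) * dser (xi R 1)) = 1.
  by rewrite /res coef_xiM /= subrr add0r.
rewrite affine_bracket_tens // tt res1 mulr1 affine_split.
rewrite (linear_funD _ _ l_lin) lx add0r (linear_funZ _ _ l_lin) => /eqP.
by rewrite scaler_eq0 pnatr_eq0 /= => /eqP ->; rewrite scaler0.
Qed.

End Uniqueness.

(** * The shift as conjugation by tau_mu *)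

Section TauConjugation.
Context (R : realType) (G : classical_group).
Local Notation C := R[i].

Lemma trig_period (m : int) :
  cos ((2 * pi) *~ m) = 1 :> R /\ sin ((2 * pi) *~ m) = 0 :> R.
Proof.
rewrite mulr_natl; have periods n : cos (pi *+ 2 *+ n) = 1 :> R /\
    sin (pi *+ 2 *+ n) = 0 :> R.
  have := periodicn (@cosD2pi R) n 0; have := periodicn (@sinD2pi R) n 0.
  by rewrite !add0r cos0 sin0.
case: m => n; first exact: periods.
have [c1 s0] := periods n.+1.
by rewrite NegzE mulrNz cosN sinN -pmulrn c1 s0 oppr0.
Qed.

(** A change of branch multiplies xi^n by exp(2 pi i k n), which is 1 for an integer n. *)
Lemma cexp_period (k n : int) :
  cexp (n%:~R * ((2 * pi) *~ k)*i%C) = 1 :> R[i].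
Proof.
have -> : n%:~R * ((2 * pi) *~ k)*i%C = ((2 * pi) *~ (k * n))*i%C :> C.
  rewrite -(rmorph_int (real_complex R)) mulrzA -[_ *~ k *~ n]mulrzl.
  by apply/eqP; rewrite eq_complex /= mulr0 !mul0r subr0 addr0 !eqxx.
rewrite /cexp /= expR0; have [-> ->] := trig_period (k * n).
by rewrite mul1r.
Qed.

(** Conjugation multiplies the entry at [(i, j)] by xi^(mu_i - mu_j). The exponents mu_i may be
    fractional, but their difference is an integer wherever some element of g has a nonzero
    entry. *)
Lemma loop_shift_conj (k : int) (mu : cartan R G) (x : loop R G) :
  in_coweight_lattice mu ->
  loop_mx (loop_shift mu x) = tau k mu *m loop_mx x *m invmx (tau k mu).
Proof.
move=> muP; apply: canRL (mulmxK (tau_unitmx k mu)) _.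
rewrite /tau mul_mx_diag mul_diag_mx; apply/matrixP => i j.
rewrite !mxE mulrC /xipow; apply: series_ext => a.
set entry := fun X : glie R G => vsval X i j.
rewrite [LHS]coef_monoM [RHS]coef_monoM.
have entry0 : entry 0 = 0 by apply: entry0.
have [[n wn]|noint] := pselect (exists n : int, weight R i j mu = n%:~R).
  have mij : vsval (vsval mu) i i = vsval (vsval mu) j j + n%:~R.
    by rewrite -wn weightE addrC subrK.
  rewrite mij [(_ + n%:~R) * _]mulrDl cexpD cexp_period mulr1 opprD addrA.
  congr (_ * _).
  move: (a - _) => b.
  have [[m ->]|nob] := pselect (exists m : int, b = m%:~R).
    rewrite -rmorphB !coef_map_expo // /entry loop_shift_entry.
    by rewrite (shiftE wn).
  rewrite !coef_map_expo_out // => m; apply/eqP => mE; apply: nob.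
    by exists (m + n); rewrite rmorphD /= mE subrK.
  by exists m.
(* When the weight is not integral at [mu], every element of g has entry 0 at [(i, j)]. *)
have vanish (y : loop R G) b : map_expo C entry y b = 0.
  have [[m ->]|nob] := pselect (exists m : int, b = m%:~R).
    rewrite coef_map_expo //; apply/eqP; apply: contra_notT noint.
    exact: weight_coweight.
  by rewrite coef_map_expo_out // => m; apply/eqP => mE; apply: nob; exists m.
by rewrite !vanish !mulr0.
Qed.

End TauConjugation.

(** * The single shift as the unique extension of phi_mu *)

Theorem corollary1 (R : realType) (G : classical_group)
    (simpleG : simple_group G)
    (form : glie R G -> glie R G -> R[i]) (formN : normalized_form form)
    (Xr : cartan_dual R G -> glie R G)
    (XrP : forall alpha, is_root alpha ->
       Xr alpha != 0 /\ in_root_space alpha (Xr alpha))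
    (mu : cartan R G) (muP : in_coweight_lattice mu) :
  exists phi : loop R G -> loop R G,
    [/\ forall (k : int) (x : loop R G),
          loop_mx (phi x) = tau k mu *m loop_mx x *m invmx (tau k mu),
        lie_automorphism (@loop_bracket R G) phi &
        exists sigma : affine R G -> affine R G,
          [/\ single_shift form Xr mu sigma,
              forall sigma', single_shift form Xr mu sigma' -> sigma' =1 sigma,
              lie_automorphism (affine_bracket form) sigma,
              induces sigma phi &
              forall psi : affine R G -> affine R G,
                lie_automorphism (affine_bracket form) psi ->
                induces psi phi -> psi =1 sigma]].
Proof.
have form_inv := normalized_invariant formN.
have sigmaP := affine_shift_single_shift form_inv mu XrP.
have sigma_auto : lie_automorphism (affine_bracket form) (affine_shift form mu).
  split; [exact: affine_shift_linear | exact: affine_shift_bij |].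
  by move=> u v; apply: affine_shift_bracket.
have sigma_phi : induces (affine_shift form mu) (loop_shift mu) by [].
exists (loop_shift mu); split=> [k x||].
- exact: loop_shift_conj.
- split; [exact: loop_shift_linear | exact: loop_shift_bij |].
  by move=> x y; apply: loop_shift_bracket.
exists (affine_shift form mu); split=> // [sigma' sigma'P|psi psi_auto psi_phi].
  exact: single_shift_unique XrP muP sigma'P sigmaP.
exact: extension_unique psi_auto sigma_auto psi_phi sigma_phi.
Qed.
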